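(* Let $p$ be a prime and $m \ge 1$ an integer. Let $\lambda_0, \lambda_1, \ldots, \lambda_m \in \mathbb{Z}$ with $\lambda_i \neq 0$ for some $i$, and let $\alpha_1, \ldots, \alpha_m \in \mathbb{Q}$ be pairwise distinct and non-zero. Let $Q>0$ be an integer such that $Q\alpha_i\in\mathbb{Z}$ for all $i=1,\ldots,m$. Assume that $M>1$, $\alpha<1$, $H>1$, $$\frac{-\log f(m,M,Q,\alpha)}{2^{m-1} e^{1.03883m} Q^m H \cdot \frac{M^{m+1}}{M-1} \cdot (m+1)(m+2) \alpha} \ge -\frac{1}{e},$$ $$\log f(m,M,Q,\alpha)\ge 1$$ and $$\log H\ge\max\left\{1.03883m,\ (m+1)\log M,\ \log(m+2),\ m\log Q\right\}.$$ Then $$|\Lambda_p|_p>\frac{M-1}{6^m(m+1)e^{2.07766m}Q^{2m}M^{2m+1}}\,H^{-1-14\log 2-14m\log(3e^{1.03883}QM)}.$$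
   Context: $|\cdot|_p$ is the $p$-adic absolute value (with $|p|_p=1/p$), $|\cdot|$ the usual absolute value. $\boldsymbol{\log}$ denotes the $p$-adic logarithm, $\boldsymbol{\log}(1+t)=\sum_{n=0}^\infty \frac{(-1)^n}{n+1}t^{n+1}$, which converges $p$-adically for $|t|_p<1$; non-bold $\log$ is the real natural logarithm. $\Lambda_p := \lambda_0+\lambda_1\boldsymbol{\log}(1+\alpha_1)+\ldots+\lambda_m\boldsymbol{\log}(1+\alpha_m)$, $M:=\max_{1\le i\le m}|\alpha_i|$, $\alpha:=\max_{1\le i\le m}|\alpha_i|_p$, $H:=\max_{0\le i\le m}|\lambda_i|$. $$f(m,M,Q,\alpha):=2^{-1}\cdot 3^{-m}e^{-1.03883m}Q^{-m}M^{-m}\alpha^{-m-1}.$$ *)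

(* Defs.v *)
From HB Require Import structures.
From mathcomp Require Import all_boot all_order all_algebra.
From mathcomp Require Import all_classical all_reals all_analysis.
From mathcomp Require Import ring lra zify.

Set Implicit Arguments.
Unset Strict Implicit.
Unset Printing Implicit Defensive.

Import Order.TTheory GRing.Theory Num.Theory.
Import numFieldNormedType.Exports.

Local Open Scope classical_set_scope.
Local Open Scope ring_scope.

(* [logn p] is constantly 0 when [p] is not prime, so that [padic_abs p] is
   then the trivial absolute value; this makes it an absolute value for every
   [p : nat], and no primality proof has to be carried around below. *)
Definition padic_abs (p : nat) (x : rat) : rat :=
  if x == 0 then 0
  else p%:Q ^ ((logn p `|denq x|%N)%:Z - (logn p `|numq x|%N)%:Z).

Section PadicAbs.
Variable p : nat.
Lemma padic_absE (a b : int) : a != 0 -> b != 0 ->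
  padic_abs p (a%:Q / b%:Q) =
  p%:Q ^ ((logn p `|b|%N)%:Z - (logn p `|a|%N)%:Z).
Proof.
move=> a0 b0; have [x0|x0] := eqVneq (a%:Q / b%:Q) 0.
  by move: x0 => /eqP; rewrite mulf_eq0 invr_eq0 !intr_eq0 (negbTE a0) (negbTE b0).
rewrite /padic_abs (negbTE x0).
set x := a%:Q / b%:Q in x0 *.
have n0 : numq x != 0 by rewrite numq_eq0.
have d0 : denq x != 0 by rewrite denq_neq0.
have /eqP e : (numq x * b == a * denq x).
  rewrite -(eqr_int rat) !intrM.
  have bq : b%:Q != 0 by rewrite intr_eq0.
  have dq : (denq x)%:Q != 0 by rewrite intr_eq0.
  rewrite -(inj_eq (mulIf (_ : (b%:Q * (denq x)%:Q)^-1 != 0))); last first.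
    by rewrite invr_eq0 mulf_neq0.
  apply/eqP; have xE := divq_num_den x; rewrite /x in xE.
  transitivity ((numq x)%:Q / (denq x)%:Q); first by field; rewrite bq dq.
  by rewrite xE; field; rewrite bq dq.
have := congr1 (fun z : int => logn p `|z|%N) e.
rewrite !abszM !lognM ?absz_gt0 // => /(congr1 Posz).
rewrite !PoszD => {}e; congr (_ ^ _); lia.
Qed.

Lemma padic_abs0 : padic_abs p 0 = 0. Proof. by rewrite /padic_abs eqxx. Qed.

Lemma padic_abs1 : padic_abs p 1 = 1.
Proof. by rewrite -[1]divr1 -[1]/(1%:Q) padic_absE// subrr expr0z. Qed.

Lemma padic_absN x : padic_abs p (- x) = padic_abs p x.
Proof. by rewrite /padic_abs oppr_eq0 numqN denqN abszN. Qed.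

Lemma padic_abs_gt0 x : x != 0 -> 0 < padic_abs p x.
Proof.
move=> x0; rewrite /padic_abs (negbTE x0); case: (posnP p) => [->|p0].
  by rewrite /logn /= subrr expr0z.
by rewrite exprz_gt0// ltr0z.
Qed.

Lemma padic_abs_ge0 x : 0 <= padic_abs p x.
Proof.
by have [->|/padic_abs_gt0/ltW//] := eqVneq x 0; rewrite padic_abs0.
Qed.

Lemma padic_abs_eq0 x : (padic_abs p x == 0) = (x == 0).
Proof.
have [->|x0] := eqVneq x 0; first by rewrite padic_abs0 eqxx.
by rewrite gt_eqF// padic_abs_gt0.
Qed.

Lemma padic_absM x y : padic_abs p (x * y) = padic_abs p x * padic_abs p y.
Proof.
have [->|x0] := eqVneq x 0; first by rewrite mul0r padic_abs0 mul0r.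
have [->|y0] := eqVneq y 0; first by rewrite mulr0 padic_abs0 mulr0.
have -> : x * y = (numq x * numq y)%:Q / (denq x * denq y)%:Q.
  rewrite -{1}(divq_num_den x) -{1}(divq_num_den y) !intrM.
  by field; rewrite !intr_eq0 !denq_neq0.
rewrite padic_absE ?mulf_neq0 ?numq_eq0 ?denq_neq0// /padic_abs.
rewrite (negbTE x0) (negbTE y0) !abszM.
rewrite !lognM ?absz_gt0 ?numq_eq0 ?denq_neq0//.
case: (boolP (prime p)) => [pp|/negbTE np]; last first.
  by rewrite /logn np /= !subrr !expr0z mulr1.
rewrite -expfzDr; last by rewrite intr_eq0; have := prime_gt0 pp; lia.
by congr (_ ^ _); rewrite !PoszD; ring.
Qed.

Lemma padic_absV x : padic_abs p x^-1 = (padic_abs p x)^-1.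
Proof.
have [->|x0] := eqVneq x 0; first by rewrite !(invr0, padic_abs0).
apply: (mulfI (_ : padic_abs p x != 0)); first by rewrite padic_abs_eq0.
by rewrite -padic_absM !mulfV ?padic_abs_eq0// padic_abs1.
Qed.

Lemma padic_absD x y :
  padic_abs p (x + y) <= Num.max (padic_abs p x) (padic_abs p y).
Proof.
have [->|x0] := eqVneq x 0; first by rewrite add0r le_max lexx orbT.
have [->|y0] := eqVneq y 0; first by rewrite addr0 le_max lexx.
have [->|xy0] := eqVneq (x + y) 0.
  by rewrite padic_abs0 le_max padic_abs_ge0.
case: (boolP (prime p)) => [pp|/negbTE np]; last first.
  by rewrite /padic_abs (negbTE x0) (negbTE y0) (negbTE xy0)
     /logn np /= !subrr !expr0z le_max lexx.
pose a : int := numq x * denq y; pose b : int := numq y * denq x.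
pose d := denq x * denq y.
have d0 : d != 0 by rewrite mulf_neq0 ?denq_neq0.
have a0 : a != 0 by rewrite mulf_neq0 ?denq_neq0 ?numq_eq0.
have b0 : b != 0 by rewrite mulf_neq0 ?denq_neq0 ?numq_eq0.
have xE : x = a%:Q / d%:Q.
  rewrite -{1}(divq_num_den x) !intrM.
  by field; rewrite !intr_eq0 !denq_neq0.
have yE : y = b%:Q / d%:Q.
  rewrite -{1}(divq_num_den y) !intrM.
  by field; rewrite !intr_eq0 !denq_neq0.
have xyE : x + y = (a + b)%:Q / d%:Q by rewrite xE yE -mulrDl -intrD.
have ab0 : a + b != 0.
  by apply: contraNneq xy0 => e; rewrite xyE e mul0r.
rewrite xyE xE yE !padic_absE//.
have p1 : 1 <= p%:Q by rewrite -[1]/(1%:Q) ler_int; have := prime_gt0 pp; lia.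
suff : (minn (logn p `|a|%N) (logn p `|b|%N) <= logn p `|(a + b)%R|%N)%N.
  rewrite le_max geq_min => /orP[h|h]; apply/orP; [left|right];
  by apply: ler_weXz2l => //; lia.
rewrite -pfactor_dvdn ?absz_gt0//.
suff : ((p ^ minn (logn p `|a|%N) (logn p `|b|%N))%N%:Z %| (a + b)%R)%Z by [].
by apply: rpredD; rewrite /= unfold_in /= pfactor_dvdn ?absz_gt0// geq_min leqnn ?orbT.
Qed.

End PadicAbs.

Section CauchySequences.
Variable p : nat.

Definition padic_cauchy : {pred nat -> rat} := [pred u : nat -> rat |
  `[< forall e : rat, 0 < e -> exists N, forall m n, (N <= m)%N -> (N <= n)%N ->
        padic_abs p (u m - u n) < e >]].

Lemma padic_cauchyP (u : nat -> rat) :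
  reflect (forall e : rat, 0 < e -> exists N, forall m n,
             (N <= m)%N -> (N <= n)%N -> padic_abs p (u m - u n) < e)
          (u \in padic_cauchy).
Proof. exact: asboolP. Qed.

Lemma padic_abs_lt_sub (x y z : rat) e :
  padic_abs p (x - y) < e -> padic_abs p (y - z) < e -> padic_abs p (x - z) < e.
Proof.
move=> xy yz; rewrite -[x](subrK y) -addrA.
by apply: le_lt_trans (padic_absD _ _ _) _; rewrite gt_max xy.
Qed.

Lemma padic_cauchy_bounded u : u \in padic_cauchy ->
  exists2 C, 0 < C & exists N, forall n, (N <= n)%N -> padic_abs p (u n) <= C.
Proof.
move=> /padic_cauchyP/(_ 1 ltr01)[N uN].
exists (Num.max (padic_abs p (u N)) 1); first by rewrite lt_max ltr01 orbT.
exists N => n Nn; rewrite -[u n](subrK (u N)) addrC.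
apply: le_trans (padic_absD _ _ _) _.
by rewrite ge_max !le_max lexx /= (ltW (uN _ _ Nn (leqnn N))) orbT.
Qed.

Fact padic_cauchy_subring : subring_closed padic_cauchy.
Proof.
split=> [|u v /padic_cauchyP uC /padic_cauchyP vC|u v uC vC].
- apply/padic_cauchyP => e e0; exists 0%N => m n _ _.
  by rewrite subrr padic_abs0.
- apply/padic_cauchyP => e e0; have [[N uN] [M vM]] := (uC _ e0, vC _ e0).
  exists (maxn N M) => m n; rewrite !geq_max => /andP[Nm Mm] /andP[Nn Mn].
  have -> : (u - v) m - (u - v) n = (u m - u n) + - (v m - v n).
    by rewrite -[(u - v) m]/(u m - v m) -[(u - v) n]/(u n - v n); ring.
  apply: le_lt_trans (padic_absD _ _ _) _; rewrite padic_absN gt_max.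
  by rewrite uN// vM.
- have [C C0 [A uA]] := padic_cauchy_bounded uC.
  have [D D0 [B vB]] := padic_cauchy_bounded vC.
  move: uC vC => /padic_cauchyP uC /padic_cauchyP vC.
  apply/padic_cauchyP => e e0.
  have [N uN] := uC _ (divr_gt0 e0 D0); have [M vM] := vC _ (divr_gt0 e0 C0).
  exists (maxn (maxn A B) (maxn N M)) => m n.
  rewrite !geq_max => /andP[/andP[Am Bm] /andP[Nm Mm]].
  move=> /andP[/andP[An Bn] /andP[Nn Mn]].
  have -> : (u * v) m - (u * v) n = u m * (v m - v n) + (u m - u n) * v n.
    by rewrite -[(u * v) m]/(u m * v m) -[(u * v) n]/(u n * v n); ring.
  apply: le_lt_trans (padic_absD _ _ _) _; rewrite !padic_absM gt_max.
  apply/andP; split.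
    apply: (@le_lt_trans _ _ (C * padic_abs p (v m - v n))).
      by rewrite ler_wpM2r ?padic_abs_ge0// uA.
    by rewrite mulrC -ltr_pdivlMr// vM.
  apply: (@le_lt_trans _ _ (padic_abs p (u m - u n) * D)).
    by rewrite ler_wpM2l ?padic_abs_ge0// vB.
  by rewrite -ltr_pdivlMr// uN.
Qed.

HB.instance Definition _ :=
  GRing.isSubringClosed.Build (nat -> rat) padic_cauchy padic_cauchy_subring.

Record cauchy_seq := CauchySeq {
  cauchy_val :> nat -> rat; cauchy_valP : cauchy_val \in padic_cauchy }.

HB.instance Definition _ := [isSub for cauchy_val].
HB.instance Definition _ := [Choice of cauchy_seq by <:].
HB.instance Definition _ := [SubChoice_isSubComNzRing of cauchy_seq by <:].

Definition padic_null : {pred cauchy_seq} := [pred u : cauchy_seq |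
  `[< forall e : rat, 0 < e ->
        exists N, forall n, (N <= n)%N -> padic_abs p (u n) < e >]].

Lemma padic_nullP (u : cauchy_seq) :
  reflect (forall e : rat, 0 < e ->
             exists N, forall n, (N <= n)%N -> padic_abs p (u n) < e)
          (u \in padic_null).
Proof. exact: asboolP. Qed.

Fact padic_null_idealr : idealr_closed padic_null.
Proof.
split=> [||a u v /padic_nullP u0 /padic_nullP v0].
- by apply/padic_nullP => e e0; exists 0%N => n _; rewrite padic_abs0.
- apply/negP => /padic_nullP/(_ 1 ltr01)[N /(_ N (leqnn N))].
  by rewrite padic_abs1 ltxx.
- have [C C0 [A uA]] := padic_cauchy_bounded (cauchy_valP a).
  apply/padic_nullP => e e0.
  have [N uN] := u0 _ (divr_gt0 e0 C0); have [M vM] := v0 _ e0.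
  exists (maxn A (maxn N M)) => n; rewrite !geq_max => /and3P[An Nn Mn].
  have -> : (a * u + v) n = a n * u n + v n by [].
  apply: le_lt_trans (padic_absD _ _ _) _; rewrite !padic_absM gt_max vM// andbT.
  apply: (@le_lt_trans _ _ (C * padic_abs p (u n))).
    by rewrite ler_wpM2r ?padic_abs_ge0// uA.
  by rewrite mulrC -ltr_pdivlMr// uN.
Qed.

HB.instance Definition _ := isIdealr.Build cauchy_seq padic_null padic_null_idealr.

(* A Cauchy sequence which is not null has an eventually constant absolute
   value, by the ultrametric inequality. *)
Lemma cauchy_seq_absP (u : cauchy_seq) : u \notin padic_null ->
  exists2 c, 0 < c & exists N, forall n, (N <= n)%N -> padic_abs p (u n) = c.
Proof.
move=> /padic_nullP/existsNP[e /not_implyP[e0 /forallNP uN]].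
have /padic_cauchyP/(_ _ e0)[N uC] := cauchy_valP u.
have /existsNP[k /not_implyP[Nk /negP]] := uN N; rewrite -leNgt => uk.
have cst n : (N <= n)%N -> padic_abs p (u n) = padic_abs p (u k).
  move=> Nn; apply/eqP; rewrite eq_le.
  have kn := uC _ _ Nk Nn; have nk := uC _ _ Nn Nk.
  have h : padic_abs p (u n) <= padic_abs p (u k).
    rewrite -[u n](subrK (u k)) (le_trans (padic_absD _ _ _))// ge_max lexx andbT.
    by rewrite ltW// (lt_le_trans nk).
  rewrite h /= leNgt; apply/negP => lt.
  have := padic_absD p (u k - u n) (u n); rewrite subrK le_max.
  by rewrite [X in _ || X]leNgt lt orbF leNgt (lt_le_trans kn).
by exists (padic_abs p (u k)); [exact: lt_le_trans uk|exists N].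
Qed.

Fact cauchy_seq_inv_subproof (u : cauchy_seq) :
  (if u \in padic_null then 0 else fun n => (u n)^-1) \in padic_cauchy.
Proof.
case: ifPn => [_|/cauchy_seq_absP[c c0 [N uN]]]; first exact: rpred0.
apply/padic_cauchyP => e e0.
have /padic_cauchyP/(_ _ (mulr_gt0 e0 (mulr_gt0 c0 c0)))[M uM] := cauchy_valP u.
exists (maxn N M) => m n; rewrite !geq_max => /andP[Nm Mm] /andP[Nn Mn].
have nz k : (N <= k)%N -> u k != 0.
  by move=> Nk; rewrite -(padic_abs_eq0 p) uN// gt_eqF.
have -> : (u m)^-1 - (u n)^-1 = (u n - u m) * (u m * u n)^-1.
  by field; rewrite !nz.
rewrite padic_absM padic_absV padic_absM !uN// ltr_pdivrMr ?mulr_gt0//.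
exact: uM.
Qed.

Definition cauchy_seq_inv (u : cauchy_seq) := CauchySeq (cauchy_seq_inv_subproof u).

End CauchySequences.

Arguments padic_null : clear implicits.

(* The field of p-adic numbers, as the completion of [rat] for [padic_abs p]:
   Cauchy sequences of rationals modulo null sequences. *)
Definition Qp (p : nat) : Type := {ideal_quot (padic_null p)}.

Section Qp.
Variable p : nat.
Local Open Scope quotient_scope.

HB.instance Definition _ := GRing.ComNzRing.on (Qp p).
HB.instance Definition _ := NzRingQuotient.on (Qp p).

Definition Qp_inv (x : Qp p) : Qp p := \pi_(Qp p) (cauchy_seq_inv (repr x)).

Lemma Qp_eq0 (x : Qp p) : (x == 0) = (repr x \in padic_null p).
Proof.
rewrite -[x in LHS]reprK. rewrite -[0]/(0 : {ideal_quot (padic_null p)}).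
by rewrite piE /= /Quotient.equiv subr0.
Qed.

Fact Qp_mulVf (x : Qp p) : x != 0 -> Qp_inv x * x = 1.
Proof.
move=> x0; rewrite -[x in _ * x]reprK.
have := x0; rewrite Qp_eq0 => xN; have [c c0 [N uN]] := cauchy_seq_absP xN.
apply/eqP; rewrite !piE /= /Quotient.equiv; apply/padic_nullP => e e0.
exists N => n Nn.
have nz : repr x n != 0 by rewrite -(padic_abs_eq0 p) uN// gt_eqF.
have h : padic_abs p (cauchy_seq_inv (repr x) n * repr x n - 1) < e.
  by rewrite /= (negbTE xN) mulVf// subrr padic_abs0.
exact: h.
Qed.

Fact Qp_invr0 : Qp_inv 0 = 0.
Proof.
rewrite /Qp_inv; set u := cauchy_seq_inv _.
have -> : u = 0; last by rewrite !piE.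
apply: val_inj => /=; rewrite ifT//.
by rewrite -Qp_eq0.
Qed.

HB.instance Definition _ := GRing.ComNzRing_isField.Build (Qp p) Qp_mulVf Qp_invr0.

End Qp.

Section QpAbs.
Variable p : nat.
Local Open Scope quotient_scope.
Implicit Types (u v : cauchy_seq p) (x y : Qp p).

(* The p-adic absolute value takes rational values, so it need not be
   real-valued; the sequence in the limit is eventually constant if [x != 0]. *)
Definition Qp_abs x : rat := lim ((fun n => padic_abs p (repr x n) : rat^o) @ \oo).

Lemma padic_abs_isosceles (a b : rat) :
  padic_abs p (a - b) < padic_abs p b -> padic_abs p a = padic_abs p b.
Proof.
move=> ab; apply/eqP; rewrite eq_le; apply/andP; split.
  rewrite -{1}[a](subrK b) (le_trans (padic_absD _ _ _))//.
  by rewrite ge_max lexx (ltW ab).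
have := padic_absD p (b - a) a; rewrite subrK le_max.
by rewrite -opprB padic_absN [X in X || _]leNgt ab.
Qed.

Lemma Qp_pi_eq0 u : (\pi_(Qp p) u == 0) = (u \in padic_null p).
Proof.
rewrite -[0]/(0 : {ideal_quot (padic_null p)}).
by rewrite piE /= /Quotient.equiv subr0.
Qed.

Lemma Qp_abs0 : Qp_abs 0 = 0.
Proof.
have /padic_nullP r0 : repr (0 : Qp p) \in padic_null p by rewrite -Qp_eq0.
apply: (@cvg_lim rat^o); first exact: norm_hausdorff.
apply/cvgrPdist_lt => e e0; have [N uN] := r0 e e0.
exists N => // n /= Nn.
by rewrite sub0r normrN ger0_norm ?padic_abs_ge0// uN.
Qed.

Lemma Qp_abs_pi u c N : 0 < c ->
  (forall n, (N <= n)%N -> padic_abs p (u n) = c) -> Qp_abs (\pi_(Qp p) u) = c.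
Proof.
move=> c0 uN; set x := \pi_(Qp p) u.
have /padic_nullP/(_ _ c0)[M vM] : repr x - u \in padic_null p.
  have : x == \pi_(Qp p) (repr x) by rewrite reprK.
  by rewrite -subr_eq0 -opprB oppr_eq0 /x -!rmorphB/= Qp_pi_eq0.
apply: (@cvg_lim rat^o); first exact: norm_hausdorff.
apply/cvgrPdist_lt => e e0; exists (maxn N M) => // n /=.
rewrite geq_max => /andP[Nn Mn]; rewrite (_ : padic_abs p _ = c) ?subrr ?normr0//.
by rewrite -(uN n Nn); apply: padic_abs_isosceles; rewrite (uN n Nn); exact: vM.
Qed.

Lemma Qp_abs_repr x : x != 0 ->
  0 < Qp_abs x /\
  exists N, forall n, (N <= n)%N -> padic_abs p (repr x n) = Qp_abs x.
Proof.
rewrite Qp_eq0 => /cauchy_seq_absP[c c0 [N uN]].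
have := Qp_abs_pi c0 uN; rewrite reprK => ->; split => //.
by exists N.
Qed.

Lemma Qp_abs_ge0 x : 0 <= Qp_abs x.
Proof.
by have [->|/Qp_abs_repr[/ltW//]] := eqVneq x 0; rewrite Qp_abs0.
Qed.

Lemma Qp_abs_eq0 x : (Qp_abs x == 0) = (x == 0).
Proof.
have [->|/Qp_abs_repr[x0 _]] := eqVneq x 0; first by rewrite Qp_abs0 eqxx.
by rewrite gt_eqF.
Qed.

Lemma Qp_absM x y : Qp_abs (x * y) = Qp_abs x * Qp_abs y.
Proof.
have [->|/Qp_abs_repr[x0 [N xN]]] := eqVneq x 0.
  by rewrite mul0r Qp_abs0 mul0r.
have [->|/Qp_abs_repr[y0 [M yM]]] := eqVneq y 0.
  by rewrite mulr0 Qp_abs0 mulr0.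
rewrite -[x in LHS]reprK -[y in LHS]reprK -rmorphM/=.
apply: (@Qp_abs_pi (repr x * repr y) _ (maxn N M)); first exact: mulr_gt0.
move=> n; rewrite geq_max => /andP[Nn Mn].
by rewrite -(xN n Nn) -(yM n Mn); exact: padic_absM.
Qed.

Lemma Qp_absN x : Qp_abs (- x) = Qp_abs x.
Proof.
have [->|/Qp_abs_repr[x0 [N xN]]] := eqVneq x 0; first by rewrite oppr0.
rewrite -[x in LHS]reprK -rmorphN/=.
apply: (@Qp_abs_pi (- repr x) _ N) => // n Nn.
by rewrite -(xN n Nn); exact: padic_absN.
Qed.

Lemma Qp_absD x y : Qp_abs (x + y) <= Num.max (Qp_abs x) (Qp_abs y).
Proof.
have [->|/Qp_abs_repr[x0 [N xN]]] := eqVneq x 0.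
  by rewrite add0r le_max lexx orbT.
have [->|/Qp_abs_repr[y0 [M yM]]] := eqVneq y 0.
  by rewrite addr0 le_max lexx.
have [->|xy0] := eqVneq (x + y) 0.
  by rewrite Qp_abs0 le_max Qp_abs_ge0.
have xyE : x + y = \pi_(Qp p) (repr x + repr y) by rewrite rmorphD/= !reprK.
have : repr x + repr y \notin padic_null p by rewrite -Qp_pi_eq0 -xyE.
move=> /cauchy_seq_absP[c c0 [K cK]]; rewrite xyE (Qp_abs_pi c0 cK).
pose n := maxn N (maxn M K).
rewrite -(xN n) ?leq_max ?leqnn// -(yM n) ?leq_max ?leqnn ?orbT//.
rewrite -(cK n) ?leq_max ?leqnn ?orbT//.
exact: padic_absD.
Qed.

Fact cauchy_seq_cst_subproof (q : rat) : (fun=> q) \in padic_cauchy p.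
Proof. by apply/padic_cauchyP => e e0; exists 0%N => *; rewrite subrr padic_abs0. Qed.

Definition Qp_of_rat (q : rat) : Qp p :=
  \pi_(Qp p) (CauchySeq (cauchy_seq_cst_subproof q)).

Fact Qp_of_rat_zmod : zmod_morphism Qp_of_rat.
Proof. by move=> a b; rewrite /Qp_of_rat -rmorphB; congr (\pi _); apply: val_inj. Qed.

Fact Qp_of_rat_monoid : monoid_morphism Qp_of_rat.
Proof.
split; first by rewrite /Qp_of_rat -[RHS](rmorph1 (\pi_(Qp p))); congr (\pi _); apply: val_inj.
by move=> a b; rewrite /Qp_of_rat -rmorphM; congr (\pi _); apply: val_inj.
Qed.

HB.instance Definition _ :=
  GRing.isZmodMorphism.Build rat (Qp p) Qp_of_rat Qp_of_rat_zmod.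
HB.instance Definition _ :=
  GRing.isMonoidMorphism.Build rat (Qp p) Qp_of_rat Qp_of_rat_monoid.

Lemma Qp_abs_ratr (q : rat) : Qp_abs (ratr q) = padic_abs p q.
Proof.
rewrite -(fmorph_eq_rat Qp_of_rat).
have [->|q0] := eqVneq q 0; first by rewrite rmorph0 Qp_abs0 padic_abs0.
by apply: (@Qp_abs_pi _ _ 0%N) => //; exact: padic_abs_gt0.
Qed.

End QpAbs.

Section QpMetric.
Variable p : nat.
Implicit Types x y z : Qp p.

Let Qp_dist x y := Qp_abs (x - y).

Fact Qp_distxx x : Qp_dist x x = 0.
Proof. by rewrite /Qp_dist subrr Qp_abs0. Qed.

Fact Qp_dist_positivity x y : Qp_dist x y = 0 -> x = y.
Proof. by move/eqP; rewrite Qp_abs_eq0 subr_eq0 => /eqP. Qed.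

Fact Qp_dist_sym x y : Qp_dist x y = Qp_dist y x.
Proof. by rewrite /Qp_dist -opprB Qp_absN. Qed.

Fact Qp_dist_triangle y x z : Qp_dist x z <= Qp_dist x y + Qp_dist y z.
Proof.
have := Qp_absD (x - y) (y - z); rewrite addrA subrK => /le_trans; apply.
by rewrite ge_max lerDl lerDr !Qp_abs_ge0.
Qed.

HB.instance Definition _ := isMetric.Build rat (Qp p)
  Qp_distxx Qp_dist_positivity Qp_dist_sym Qp_dist_triangle.
HB.instance Definition _ := isPointed.Build (Qp p) 0.

Lemma Qp_ballE x (e : rat) y : ball x e y = (Qp_abs (x - y) < e).
Proof. by rewrite ballEmdist. Qed.

Lemma Qp_cvgP (u : nat -> Qp p) x :
  u @ \oo --> x <-> forall e : rat, 0 < e ->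
    exists N, forall n, (N <= n)%N -> Qp_abs (u n - x) < e.
Proof.
split=> [/cvg_ballP ux e e0|ux].
  have [N _ uN] := ux e e0; exists N => n /uN/=.
  by rewrite Qp_ballE -opprB Qp_absN.
apply/cvg_ballP => e e0; have [N uN] := ux e e0.
by exists N => // n /uN/=; rewrite Qp_ballE -opprB Qp_absN.
Qed.

Lemma Qp_rat_dense x (e : rat) : 0 < e ->
  exists q : rat, Qp_abs (x - ratr q) < e.
Proof.
move=> e0; have /padic_cauchyP/(_ _ e0)[N uN] := cauchy_valP (repr x).
exists (repr x N); rewrite -(fmorph_eq_rat (@Qp_of_rat p)).
have [->|nz] := eqVneq (x - Qp_of_rat p (repr x N)) 0; first by rewrite Qp_abs0.
set w := repr x - CauchySeq (cauchy_seq_cst_subproof p (repr x N)).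
have wE : (x - Qp_of_rat p (repr x N)) = (\pi_(Qp p) w)%qT.
  by rewrite rmorphB/= reprK.
move: nz; rewrite wE Qp_pi_eq0 => /cauchy_seq_absP[c c0 [M cM]].
rewrite (Qp_abs_pi c0 cM) -(cM (maxn N M)) ?leq_maxr//.
by apply: uN; rewrite ?leq_maxl.
Qed.

Lemma Qp_complete (u : nat -> Qp p) :
  (forall e : rat, 0 < e -> exists N, forall m n, (N <= m)%N -> (N <= n)%N ->
     Qp_abs (u m - u n) < e) -> cvgn u.
Proof.
move=> uC.
have inv_gt0 n : 0 < (n.+1%:R^-1 : rat) by rewrite invr_gt0 ltr0n.
have /choice[q qE] n := Qp_rat_dense (u n) (inv_gt0 n).
have small (e : rat) : 0 < e -> exists N, forall n, (N <= n)%N -> Qp_abs (u n - ratr (q n)) < e.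
  move=> e0; have [N Ne] : exists N, e^-1 < N%:R.
    by exists (Num.bound e^-1); rewrite archi_boundP// invr_ge0 ltW.
  exists N => n Nn; apply: lt_trans (qE n) _.
  by rewrite invf_plt ?posrE// (lt_le_trans Ne)// ler_nat leqW.
have tri (x y z : Qp p) e : Qp_abs (x - y) < e -> Qp_abs (y - z) < e -> Qp_abs (x - z) < e.
  move=> xy yz; rewrite -[x](subrK y) -addrA.
  by apply: le_lt_trans (Qp_absD _ _) _; rewrite gt_max xy.
have qC : q \in padic_cauchy p.
  apply/padic_cauchyP => e e0.
  have [N uN] := uC e e0; have [M qM] := small e e0.
  exists (maxn N M) => m n; rewrite !geq_max => /andP[Nm Mm] /andP[Nn Mn].
  rewrite -Qp_abs_ratr -!(fmorph_eq_rat (@Qp_of_rat p)) rmorphB/=.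
  rewrite !(fmorph_eq_rat (@Qp_of_rat p)).
  apply: tri (tri _ _ _ _ (uN m n Nm Nn) (qM n Mn)).
  by rewrite -opprB Qp_absN qM.
pose l : Qp p := (\pi_(Qp p) (CauchySeq qC))%qT.
apply/cvg_ex; exists l; apply/Qp_cvgP => e e0.
have [M qM] := small e e0; have /padic_cauchyP/(_ _ e0)[N qN] := qC.
exists (maxn N M) => n; rewrite geq_max => /andP[Nn Mn].
apply: tri (qM n Mn) _.
pose w := CauchySeq (cauchy_seq_cst_subproof p (q n)) - CauchySeq qC.
have -> : ratr (q n) - l = (\pi_(Qp p) w)%qT.
  by rewrite rmorphB/= -(fmorph_eq_rat (@Qp_of_rat p)).
have [->|] := eqVneq (\pi_(Qp p) w)%qT 0.
  by rewrite Qp_abs0.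
rewrite Qp_pi_eq0 => /cauchy_seq_absP[c c0 [K cK]].
rewrite (Qp_abs_pi c0 cK) -(cK (maxn N K)) ?leq_maxr//.
by apply: qN; rewrite ?leq_maxl.
Qed.

End QpMetric.

(* The p-adic logarithm, as a function of [x = 1 + t]: the series in the powers
   of [t = x - 1], which converges for [Qp_abs (x - 1) < 1]. *)
Definition Qp_log (p : nat) (x : Qp p) : Qp p :=
  lim (series (fun n => (-1) ^+ n / n.+1%:R * (x - 1) ^+ n.+1) @ \oo).

Section LinearForm.
Variables (p m : nat) (lambda : 'I_m.+1 -> int) (alpha : 'I_m -> rat).

Definition linear_form : Qp p :=
  (lambda ord0)%:~R +
  \sum_(i < m) (lambda (lift ord0 i))%:~R * Qp_log (1 + ratr (alpha i)).

Definition max_abs : rat := \big[Num.max/0]_(i < m) `|alpha i|.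

Definition max_padic_abs : rat := \big[Num.max/0]_(i < m) padic_abs p (alpha i).

Definition height : nat := \max_(i < m.+1) `|lambda i|%N.

End LinearForm.

Section Constants.
Variable R : realType.

(* 1.03883 and 2.07766; the decimals are split off because larger literals are
   unreasonably expensive in unary notation. *)
Definition c103883 : R := 1 + 3883 / 10 ^+ 5.
Definition c207766 : R := 2 + 7766 / 10 ^+ 5.

Definition f_bound (m : nat) (M : R) (Q : nat) (a : R) : R :=
  2^-1 * 3 ^- m * expR (- (c103883 * m%:R)) * Q%:R ^- m * M ^- m * a ^- m.+1.

End Constants.

Arguments c103883 {R}.
Arguments c207766 {R}.

(* Main.v *)
From Stdlib Require Import NArith.
Require Import Defs.
From mathcomp Require Import all_boot all_order all_algebra.
From mathcomp Require Import all_classical all_reals all_analysis.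
From mathcomp Require Import zify ring lra.

Set Implicit Arguments.
Unset Strict Implicit.
Unset Printing Implicit Defensive.

Import Order.TTheory GRing.Theory Num.Theory.

(* Type II Pade approximation of the logarithms.  Put
   Om(x) = prod_j (x - a_j)^n and, for 0 <= mu <= m, let P be the n-th divided
   derivative of x^(n+mu) Om(x).  Expanding log(1+a) as a power series, the
   number P(-1) log(1+a_j) - T_j(P), with T_j(P) = sum_h (-1)^h P_h s_h(a_j) and
   s_h the h-th partial sum of the series, is small p-adically, because P is
   orthogonal on [0, a_j] to the polynomials of degree < n.  After
   multiplication by lcm(1, ..., mn+m) Q^(mn+m) the numbers P(-1) and T_j(P)
   are integers, so that N = l_0 P(-1) + sum_j l_j T_j(P) is an integer which,
   if nonzero, has |N|_p >= 1/|N|; once this exceeds the p-adic size of the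
   remainder, |Lambda|_p >= |N|_p.  Some mu in 0..m gives N <> 0: otherwise a
   nonzero combination P_g of the P's has P_g(-1) = 0 and T_j(P_g) = 0 for all j,
   and then a solution of (1+x) Y' - n Y = x^n Om g vanishes to order n+1
   at 0 and at every a_j, which its degree forbids.

   The constant e^1.03883 of the statement is the Rosser-Schoenfeld bound for
   lcm(1..n)^(1/n).  Here the weaker and elementary bound 27/8 is enough,
   because the binomial sums are estimated by 3 (5/2)^m instead of 2 * 3^m, and
   (5/2)(27/8) < 3 e^1.03883.  The n-th root of the remainder is then at most
   3/(2e), and n ~ 12 log H is admissible. *)

(** * The least common multiple of 1, ..., n *)

Definition lcm_upto (n : nat) : nat := \big[lcmn/1]_(1 <= i < n.+1) i.

Lemma lcm_upto0 : lcm_upto 0 = 1.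
Proof. by rewrite /lcm_upto big_geq. Qed.

Lemma lcm_uptoS n : lcm_upto n.+1 = lcmn (lcm_upto n) n.+1.
Proof. by rewrite /lcm_upto big_nat_recr. Qed.

Lemma lcm_upto_gt0 n : 0 < lcm_upto n.
Proof. by elim: n => [|n IH]; rewrite ?lcm_upto0// lcm_uptoS lcmn_gt0 IH. Qed.

Lemma dvdn_lcm_upto n i : 0 < i <= n -> i %| lcm_upto n.
Proof.
elim: n => [|n IH]; first by case: i.
rewrite lcm_uptoS => /andP[i0]; rewrite leq_eqVlt => /predU1P[->|ilt].
  exact: dvdn_lcmr.
by rewrite (dvdn_trans _ (dvdn_lcml _ _))// IH// i0.
Qed.

Lemma lcm_upto_dvd n m : n <= m -> lcm_upto n %| lcm_upto m.
Proof.
elim: m => [|m IH]; first by rewrite leqn0 => /eqP->.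
rewrite leq_eqVlt => /predU1P[->//|]; rewrite ltnS => /IH h.
by rewrite lcm_uptoS (dvdn_trans h)// dvdn_lcml.
Qed.

Lemma logn_lcm_upto p n : prime p -> logn p (lcm_upto n) = trunc_log p n.
Proof.
move=> pp; have p1 := prime_gt1 pp.
apply/eqP; rewrite eqn_leq; apply/andP; split; last first.
  have [->|n0] := posnP n; first by rewrite trunc_log0.
  rewrite -pfactor_dvdn ?lcm_upto_gt0//; apply: dvdn_lcm_upto.
  by rewrite expn_gt0 ltnW//= trunc_logP.
elim: n => [|n IH]; first by rewrite lcm_upto0 logn1.
rewrite lcm_uptoS logn_lcm ?lcm_upto_gt0// geq_max.
rewrite (leq_trans IH) ?leq_trunc_log//=.
apply: trunc_log_max => //; apply: dvdn_leq => //; exact: pfactor_dvdnn.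
Qed.

(** Writes the exponent of p in [lcm_upto n] as a sum over powers of p, in parallel with Legendre's
    formula for factorials, so that both can be compared term by term. The common range up to [N]
    serves every argument at once. *)
Lemma trunc_log_sum p n N : prime p -> n <= N ->
  trunc_log p n = \sum_(1 <= j < N.+1) (p ^ j <= n).
Proof.
move=> pp nN; have p1 := prime_gt1 pp; set t := trunc_log p n.
have [n0|n0] := posnP n.
  rewrite /t n0 trunc_log0.
  rewrite big1_seq// => i _; apply/eqP; rewrite eqb0 -ltnNge expn_gt0; lia.
have tN : t <= N.
  have : p ^ t <= n by apply: trunc_logP.
  have := ltn_expl t p1; lia.
rewrite (big_cat_nat (n := t.+1))//= [X in _ + X]big1_seq => [|j]; last first.
  rewrite mem_index_iota => /andP[_ /andP[tj _]]; apply/eqP; rewrite eqb0.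
  rewrite -ltnNge; apply: leq_trans (trunc_log_ltn n p1) _.
  by rewrite leq_exp2l.
rewrite addn0 (eq_big_nat _ _ (F2 := fun=> 1)) => [|j /andP[_ jt]].
  by rewrite sum_nat_const_nat; lia.
suff -> : p ^ j <= n by [].
by apply: leq_trans (trunc_logP p1 n0); rewrite leq_exp2l.
Qed.

(* Chebyshev's method with 1 = 1/2 + 1/3 + 1/8 + 1/24: for integral x >= 1 the
   quantity x - [x/2] - [x/3] - [x/8] - [x/24] is positive unless 24 | x. *)
Lemma lcm_upto24_dvd k :
  (12 * k)`! * (8 * k)`! * (3 * k)`! * k`! * lcm_upto (24 * k)
    %| (24 * k)`! * lcm_upto k.
Proof.
have pos n : 0 < n`! by exact: fact_gt0.
have lpos n : 0 < lcm_upto n by exact: lcm_upto_gt0.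
apply/dvdn_partP; rewrite ?muln_gt0 ?pos ?lpos// => p.
rewrite mem_primes => /andP[pp _].
rewrite p_part pfactor_dvdn ?muln_gt0 ?pos ?lpos//.
rewrite !lognM ?muln_gt0 ?pos ?lpos// !logn_lcm_upto//.
have E n : n <= 24 * k -> logn p n`! = \sum_(1 <= j < (24 * k).+1) n %/ p ^ j.
  move=> nk; rewrite logn_fact// [RHS](big_cat_nat (n := n.+1))//=.
  rewrite [X in _ = _ + X]big1_seq ?addn0// => j; rewrite mem_index_iota => /andP[_ /andP[nj _]].
  by apply: divn_small; apply: ltn_trans (ltn_expl _ (prime_gt1 pp)); lia.
rewrite !E; try lia.
rewrite !(@trunc_log_sum p _ (24 * k))//; try lia.
rewrite -!big_split /=; apply: leq_sum => j _.
have : 0 < p ^ j by rewrite expn_gt0 prime_gt0.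
move: (p ^ j) => q q0.
pose x := (24 * k) %/ q.
have h d r : 24 = d * r -> 0 < d -> (r * k) %/ q = x %/ d.
  by move=> e d0; rewrite /x -divnMA e -(divnMl d0) mulnA [d * q]mulnC.
rewrite (h 2 12)// (h 3 8)// (h 8 3)// -[X in X %/ q]mul1n (h 24 1)//.
have -> : (q <= 24 * k) = (0 < x) by rewrite divn_gt0.
have -> : (q <= k) = (0 < x %/ 24) by rewrite -(h 24 1)// mul1n divn_gt0.
rewrite -/x; move: x {h} => x; lia.
Qed.

Lemma bin_leq_exp a b N k : k <= N -> 'C(N, k) * (a ^ (N - k) * b ^ k) <= (a + b) ^ N.
Proof.
move=> kN; rewrite expnDn (bigD1 (inord k)) //= inordK ?ltnS//.
exact: leq_addr.
Qed.

(** The multinomial coefficient involved is C(24k,12k) C(12k,8k) C(4k,3k). Each factor is bounded by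
    keeping one term of (1+1)^(24k), (1+2)^(12k), (1+3)^(4k), the weights being in the proportion of
    the split. *)
Lemma fact24 k :
  (24 * k)`! <= (2 ^ 24 * 3 ^ 9) ^ k * ((12 * k)`! * (8 * k)`! * (3 * k)`! * k`!).
Proof.
have e1 := @bin_fact (24 * k) (12 * k) ltac:(lia).
have e2 := @bin_fact (12 * k) (8 * k) ltac:(lia).
have e3 := @bin_fact (4 * k) (3 * k) ltac:(lia).
have b1 := @bin_leq_exp 1 1 (24 * k) (12 * k) ltac:(lia).
have b2 := @bin_leq_exp 1 2 (12 * k) (8 * k) ltac:(lia).
have b3 := @bin_leq_exp 1 3 (4 * k) (3 * k) ltac:(lia).
rewrite !exp1n !mul1n ?muln1 in b1 b2 b3.
rewrite (_ : 24 * k - 12 * k = 12 * k) in e1; last lia.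
rewrite (_ : 12 * k - 8 * k = 4 * k) in e2; last lia.
rewrite (_ : 4 * k - 3 * k = k) in e3; last lia.
rewrite -e1 -{2}e2 -e3.
set A := 'C(24 * k, _) in b1 *; set B := 'C(_, _) in b2 *; set C := 'C(_, _) in b3 *.
suff h : A * B * C <= (2 ^ 24 * 3 ^ 9) ^ k.
  rewrite [X in X <= _](_ : _ = (A * B * C) * ((12 * k)`! * (8 * k)`! * (3 * k)`! * k`!)).
    by rewrite leq_mul2r h orbT.
  by ring.
rewrite -(leq_pmul2r (_ : 0 < 2 ^ (8 * k) * 3 ^ (3 * k))); last by rewrite muln_gt0 !expn_gt0.
have -> : (2 ^ 24 * 3 ^ 9) ^ k * (2 ^ (8 * k) * 3 ^ (3 * k))
   = (1+1) ^ (24 * k) * (1+2) ^ (12 * k) * (1+3) ^ (4 * k).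
  rewrite -[1+1]/2 -[1+2]/3 -[1+3]/(2^2) expnMn -!expnM.
  have -> : 2 * (4 * k) = 8 * k by lia.
  have -> : 12 * k = 9 * k + 3 * k by lia.
  by rewrite [3 ^ (9 * k + _)]expnD; ring.
apply: leq_trans (leq_mul (leq_mul b1 b2) b3).
rewrite leq_eqVlt; apply/orP; left; apply/eqP; ring.
Qed.

Lemma lcm_upto24 k : lcm_upto (24 * k) <= (2 ^ 24 * 3 ^ 9) ^ k * lcm_upto k.
Proof.
have := dvdn_leq _ (lcm_upto24_dvd k); rewrite muln_gt0 fact_gt0 lcm_upto_gt0.
move=> /(_ isT) h.
have F0 : 0 < (12 * k)`! * (8 * k)`! * (3 * k)`! * k`! by rewrite !muln_gt0 !fact_gt0.
rewrite -(leq_pmul2l F0); apply: leq_trans h _.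
by rewrite mulnA [X in _ <= X * _]mulnC leq_mul2r fact24 orbT.
Qed.

Lemma dvdn_to_nat (a b : N) : N.divide a b -> N.to_nat a %| N.to_nat b.
Proof.
by case=> z ->; rewrite Nnat.N2Nat.inj_mul multE dvdn_mull.
Qed.

(* d is a multiple of lcm_upto i, e = d * 8 ^ i and b = 27 ^ i; the gcd is
   computed after reduction of d, which is much larger than i. *)
Fixpoint lcm_check (k : nat) (i d e b : N) : bool :=
  if k is k'.+1 then
    let i' := N.succ i in
    let c := (i' / N.gcd (d mod i') i')%num in
    let e' := (c * (8 * e))%num in
    let b' := (27 * b)%num in
    N.leb e' b' && lcm_check k' i' (c * d)%num e' b'
  else true.

Lemma lcm_checkP k i d e b : lcm_check k i d e b ->
  lcm_upto (N.to_nat i) %| N.to_nat d -> 0 < N.to_nat d ->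
  N.to_nat e = N.to_nat d * 8 ^ N.to_nat i -> N.to_nat b = 27 ^ N.to_nat i ->
  forall j, N.to_nat i < j <= N.to_nat i + k -> lcm_upto j * 8 ^ j <= 27 ^ j.
Proof.
elim: k i d e b => [|k IH] i d e b; first by move=> _ _ _ _ _ j; lia.
cbn [lcm_check]; set i' := N.succ i; set c := (i' / _)%num.
set e' := (c * _)%num; set b' := (27 * b)%num.
move=> /andP[/N.leb_le le /IH{}IH] dd d0 eE bE.
have iE : N.to_nat i' = (N.to_nat i).+1 by rewrite /i' Nnat.N2Nat.inj_succ.
have dE : (c * d)%num = N.lcm d i'.
  by rewrite /c N.gcd_mod; [rewrite N.gcd_comm N.mul_comm|exact: N.neq_succ_0].
have eE' : N.to_nat e' = N.to_nat (c * d) * 8 ^ N.to_nat i'.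
  by rewrite iE expnS /e' !Nnat.N2Nat.inj_mul !multE eE (_ : N.to_nat 8 = 8)//; ring.
have bE' : N.to_nat b' = 27 ^ N.to_nat i'.
  by rewrite iE expnS -bE /b' Nnat.N2Nat.inj_mul multE.
rewrite dE in IH eE'.
have dd' : lcm_upto (N.to_nat i') %| N.to_nat (N.lcm d i').
  rewrite iE lcm_uptoS dvdn_lcm -iE !dvdn_to_nat ?andbT; last exact: N.divide_lcm_r.
  by apply: dvdn_trans dd _; apply: dvdn_to_nat; apply: N.divide_lcm_l.
have d0' : 0 < N.to_nat (N.lcm d i').
  rewrite lt0n; apply/eqP => /(congr1 N.of_nat); rewrite Nnat.N2Nat.id.
  by move=> /N.lcm_eq_0[z|z]; [rewrite z in d0|move: iE; rewrite z].
move=> j; rewrite addnS => /andP[ij ji]; have [jE|jE] := eqVneq j (N.to_nat i').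
  rewrite jE -bE'; apply: (@leq_trans (N.to_nat e')).
    by rewrite eE' leq_mul2r dvdn_leq// orbT.
  apply/ssrnat.leP/(proj1 (PeanoNat.Nat.compare_le_iff _ _)).
  by rewrite -Nnat.N2Nat.inj_compare.
apply: (IH dd' d0' eE' bE'); rewrite iE in jE *; move: (N.to_nat i) jE ij ji => t; lia.
Qed.

(** The range settled by computation. Beyond it the induction in [lcm_upto_leq] has k >= 22, enough
    to absorb the loss from rounding n up to a multiple of 24. *)
Lemma lcm_check_505 : lcm_check 505 0 1 1 1.
Proof. by vm_compute. Qed.

Lemma leq_exp2_19_exp3_12 : 2 ^ 19 <= 3 ^ 12.
Proof. lia. Qed.

(** Strong induction: n is rounded up to 24k, and the bound for k is fed into [lcm_upto24]. The
    induction closes because 2^93 < 3^60; this slack also pays for the rounding. *)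
Lemma lcm_upto_leq n : lcm_upto n * 8 ^ n <= 27 ^ n.
Proof.
elim/ltn_ind: n => n IH.
have [n505|n505] := leqP n 505.
  case: n {IH} n505 => [|n] n505; first by rewrite lcm_upto0.
  by apply: (lcm_checkP lcm_check_505); rewrite //= ?lcm_upto0.
pose k := (n + 23) %/ 24.
have kn : n <= 24 * k <= n + 23 by rewrite /k; lia.
have k22 : 22 <= k by rewrite /k; lia.
have {}IH := IH k ltac:(lia).
have h : lcm_upto n <= (2 ^ 24 * 3 ^ 9) ^ k * lcm_upto k.
  apply: leq_trans (lcm_upto24 k).
  by apply: dvdn_leq (lcm_upto_gt0 _) _; apply: lcm_upto_dvd; lia.
have {kn}[r [r23 nE]] : exists r, r <= 23 /\ 24 * k = n + r.
  by exists (24 * k - n); lia.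
have c e : 2 ^ (19 * e) <= 3 ^ (12 * e).
  case: e => [|e]; first by [].
  by rewrite !expnM (leq_exp2r _ _ (isT : 0 < e.+1)) leq_exp2_19_exp3_12.
have b : 2 ^ (93 * k) * 3 ^ (3 * r) <= 3 ^ (60 * k) * 2 ^ (3 * r).
  (* The exponent of 3 is split so that 3^12 >= 2^19, 3^3 >= 2^4 and 3 >= 2 apply. The exponent of 2
     on the right becomes 95k - 41, which is at least 93k. *)
  have -> : 60 * k = 12 * (5 * k - 6) + 3 + (69 - 3 * r) + 3 * r by lia.
  rewrite [3 ^ (_ + 3 * r)]expnD mulnAC leq_mul2r; apply/orP; right.
  have le23 : 2 ^ (69 - 3 * r) <= 3 ^ (69 - 3 * r).
    by case: (69 - 3 * r) => [//|e]; rewrite (leq_exp2r _ _ (isT : 0 < e.+1)).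
  rewrite [3 ^ (_ + (69 - _))]expnD [3 ^ (_ + 3)]expnD.
  apply: leq_trans (leq_mul (leq_mul (leq_mul (c _) (_ : 2 ^ 4 <= 3 ^ 3)) le23) (leqnn _)) => //.
  by rewrite -!expnD leq_exp2l//; lia.
have h1 : lcm_upto n <= 2 ^ (21 * k) * 3 ^ (12 * k).
  rewrite -(leq_pmul2r (_ : 0 < 8 ^ k)) ?expn_gt0//.
  apply: leq_trans (leq_mul h (leqnn _)) _; rewrite -mulnA.
  apply: leq_trans (leq_mul (leqnn _) IH) _.
  rewrite -[8]/(2 ^ 3) -[27]/(3 ^ 3) expnMn -!expnM.
  have -> : 24 * k = 21 * k + 3 * k by lia.
  have -> : 12 * k = 9 * k + 3 * k by lia.
  rewrite [2 ^ (_ + _)]expnD [3 ^ (_ + _)]expnD leq_eqVlt; apply/orP; left; apply/eqP; ring.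
apply: leq_trans (leq_mul h1 (leqnn _)) _.
rewrite -[8]/(2 ^ 3) -[27]/(3 ^ 3) -!expnM.
rewrite -(leq_pmul2r (_ : 0 < 2 ^ (3 * r) * 3 ^ (3 * r))) ?muln_gt0 ?expn_gt0//.
have -> : 3 ^ (3 * n) * (2 ^ (3 * r) * 3 ^ (3 * r)) = 3 ^ (12 * k) * (3 ^ (60 * k) * 2 ^ (3 * r)).
  rewrite mulnCA [3 ^ _ * 3 ^ _]mulnC -expnD mulnA -expnD mulnC; congr (_ ^ _ * _); lia.
have -> : 2 ^ (21 * k) * 3 ^ (12 * k) * 2 ^ (3 * n) * (2 ^ (3 * r) * 3 ^ (3 * r))
   = 3 ^ (12 * k) * (2 ^ (93 * k) * 3 ^ (3 * r)).
  have -> : 93 * k = 21 * k + 3 * n + 3 * r by lia.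
  rewrite ![2 ^ (_ + _)]expnD; ring.
by rewrite leq_mul2l b orbT.
Qed.

Local Open Scope ring_scope.

(** * The zero estimate *)

(** The antiderivative vanishing at 0: at i = 0 the convention that 0 has inverse 0 kills the
    constant term. *)
Definition primitive (f : {poly rat}) : {poly rat} :=
  \poly_(i < (size f).+1) (f`_i.-1 / i%:R).

Lemma coef_primitive f i : (primitive f)`_i = f`_i.-1 / i%:R.
Proof.
rewrite coef_poly; case: ltnP => //; case: i => // i fi; rewrite nth_default ?mul0r//.
Qed.

Definition log_sum (a : rat) (h : nat) : rat :=
  \sum_(k < h) (-1) ^+ k * a ^+ k.+1 / k.+1%:R.

(** The functional T_j for a = a_j. It equals minus the integral over [0, a] of (P(x) - P(-1)) / (x
    + 1). *)
Definition log_form (a : rat) (P : {poly rat}) : rat :=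
  \sum_(h < size P) (-1) ^+ h * P`_h * log_sum a h.

Lemma log_form_wide N a (P : {poly rat}) : (size P <= N)%N ->
  log_form a P = \sum_(h < N) (-1) ^+ h * P`_h * log_sum a h.
Proof.
move=> PN; rewrite /log_form (big_ord_widen N (fun h => (-1) ^+ h * P`_h * log_sum a h))//.
rewrite big_mkcond; apply: eq_bigr => h _; case: ltnP => // Ph.
by rewrite nth_default// mulr0 mul0r.
Qed.

Lemma log_form_sum (I : finType) a (c : I -> rat) (P : I -> {poly rat}) :
  log_form a (\sum_i c i *: P i) = \sum_i c i * log_form a (P i).
Proof.
pose N := maxn (size (\sum_i c i *: P i)%R) (\max_i size (P i)).
rewrite (@log_form_wide N) ?leq_maxl//.
rewrite (eq_bigr (fun i => \sum_(h < N) c i * ((-1) ^+ h * (P i)`_h * log_sum a h))).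
  rewrite exchange_big /=; apply: eq_bigr => h _.
  rewrite coef_sum. rewrite -mulrA mulr_suml mulr_sumr; apply: eq_bigr => i _.
  by rewrite coefZ; ring.
move=> i _; rewrite (@log_form_wide N) ?mulr_sumr// leq_max.
by apply/orP; right; apply: leq_bigmax.
Qed.

(** Multiplication by X + 1 pairs neighbouring partial sums with opposite signs, so that only the
    single terms s_(h+1)(a) - s_h(a) survive. *)
Lemma log_formMXaddC a Q :
  log_form a (Q * ('X - (-1)%:P)) = - (primitive Q).[a].
Proof.
have sz : (size (Q * ('X - (-1)%:P))%R <= (size Q).+1)%N.
  by rewrite (leq_trans (size_polyMleq _ _))// size_XsubC addn2.
rewrite (log_form_wide a sz).
have szp : (size (primitive Q) <= (size Q).+1)%N by exact: size_poly.
rewrite (horner_coef_wide _ szp) [in RHS]big_ord_recl coef_primitive/= invr0 mulr0 mul0r add0r.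
rewrite (eq_bigr (fun h : 'I_(size Q).+1 => (-1) ^+ h * Q`_h * log_sum a h
    + (if h == 0%N :> nat then 0 else (-1) ^+ h * Q`_h.-1 * log_sum a h))); last first.
  move=> h _; rewrite mulrDr coefD coefMX polyCN opprK mulr1.
  by case: ifP => _; ring.
rewrite big_split /= big_ord_recr /= [Q`_(size Q)]nth_default// mulr0 mul0r addr0.
rewrite [X in _ + X]big_ord_recl /= add0r -big_split -sumrN /=; apply: eq_bigr => h _.
rewrite coef_primitive /bump /= add1n /= /log_sum big_ord_recr /= -/(log_sum a h).
have e : (-1) ^+ h * (-1) ^+ h = 1 :> rat by rewrite -expr2 sqrr_sign.
rewrite [(-1) ^+ h.+1]exprS; move: (log_sum a h) => l.
transitivity (- ((-1) ^+ h * (-1) ^+ h) * (Q`_h * a ^+ h.+1 / h.+1%:R)); first by ring.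
by rewrite e; ring.
Qed.

Lemma natrS_neq0 n : (n.+1%:R : rat) != 0. Proof. by rewrite pnatr_eq0. Qed.
Lemma natr_fact_neq0 n : (n`!%:R : rat) != 0. Proof. by rewrite pnatr_eq0 -lt0n fact_gt0. Qed.

Lemma fact_binE (h n : nat) : ('C(n + h, n) * (n`! * h`!) = (n + h)`!)%N.
Proof. by rewrite -{2}(addKn n h) bin_fact// leq_addr. Qed.

(* The solution of (1 + X) Y' - n Y = W when W^`N(n) = (1 + X) Q and X^n | W. *)
Definition pade_ode_sol n (Q : {poly rat}) : {poly rat} :=
  \poly_(i < size Q + n.+1)
    (if (i <= n)%N then 0 else Q`_(i - n.+1) * (n`! * (i - n.+1)`!)%:R / i`!%:R).

Lemma coef_pade_ode_sol n Q i : (pade_ode_sol n Q)`_(n.+1 + i) =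
  Q`_i * (n`! * i`!)%:R / (n.+1 + i)`!%:R.
Proof.
rewrite coef_poly addKn; have -> : (n.+1 + i <= n)%N = false by lia.
have -> : (n.+1 + i < size Q + n.+1)%N = (i < size Q)%N by lia.
by case: ltnP => // /(nth_default 0)->; rewrite !mul0r.
Qed.

Lemma coef_pade_ode_sol0 n Q i : (i <= n)%N -> (pade_ode_sol n Q)`_i = 0.
Proof. by move=> hin; rewrite coef_poly hin if_same. Qed.

(** Translates the vanishing of the integral of Q over [0, a] into the vanishing of the n-th
    derivative of Y at a. *)
Lemma nderivn_pade_ode_sol n Q : (pade_ode_sol n Q)^`N(n) = primitive Q.
Proof.
apply/polyP => -[|h]; rewrite coef_nderivn coef_primitive.
  by rewrite addn0 coef_pade_ode_sol0// mul0rn invr0 mulr0.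
rewrite addnS -addSn coef_pade_ode_sol -mulr_natr /=.
have e : ('C(n.+1 + h, n) * (n`! * (h.+1 * h`!)))%N = (n.+1 + h)`!.
  by rewrite -factS addSnnS fact_binE.
have C0 : ('C(n.+1 + h, n)%:R : rat) != 0 by rewrite pnatr_eq0 -lt0n bin_gt0; lia.
rewrite -e !natrM; move: (h.+1%:R : rat) (natrS_neq0 h) => x x0.
by field; rewrite C0 !natr_fact_neq0 x0.
Qed.

(** The n-th derivative of (1+X) Y' - n Y is (1+X) Y^(n+1), and Y^(n+1) = n! Q, so the two sides
    agree from degree n on. Below degree n both vanish. *)
Lemma pade_ode_solE n (Q W : {poly rat}) :
  (forall i, (i < n)%N -> W`_i = 0) -> W^`N(n) = Q * ('X - (-1)%:P) ->
  (1 + 'X) * (pade_ode_sol n Q)^`() - (pade_ode_sol n Q) *+ n = W.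
Proof.
move=> W0 WE; apply/polyP => i.
rewrite mulrDl mul1r !coefD coefN coefMn coefXM !coef_deriv.
have [ni|ni] := ltnP i n.
  rewrite W0// !coef_pade_ode_sol0 ?mul0rn; try lia.
  by case: i ni => [|i] ni; rewrite /= ?coef_pade_ode_sol0 ?mul0rn ?subr0 ?addr0//; lia.
have [h ->] : exists h, i = (n + h)%N by exists (i - n)%N; lia.
have := congr1 (fun p : {poly rat} => p`_h) WE.
rewrite coef_nderivn polyCN opprK mulrDr mulr1 coefD coefMX -mulr_natr => e.
have C0 : ('C(n + h, n)%:R : rat) != 0 by rewrite pnatr_eq0 -lt0n bin_gt0; lia.
apply: (mulIf C0); rewrite {}e.
have -> : (if (n + h)%N == 0%N then 0
    else (pade_ode_sol n Q)`_(n + h).-1.+1 *+ (n + h).-1.+1)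
    = (pade_ode_sol n Q)`_(n + h) *+ (n + h).
  by case: (n + h)%N => [|k]; rewrite ?mulr0n.
rewrite mulrnDr [_ *+ n + _]addrC addrA addrK -addSn coef_pade_ode_sol.
have e : ('C(n + h, n) * (n`! * h`!))%N = (n + h)`! by exact: fact_binE.
have eS : (n.+1 + h)`! = ((n.+1 + h) * (n + h)`!)%N by rewrite addSn factS.
rewrite -(mulr_natr _ (n.+1 + h)) eS -e !natrM.
have := natr_fact_neq0 n; have := natr_fact_neq0 h; have := natrS_neq0 (n + h); rewrite -addSn.
have := congr1 (fun k : nat => k%:R : rat) e; rewrite !natrM.
move: ((n.+1 + h)%:R : rat) ('C(_, _)%:R : rat) C0 => x C C0.
case: h {ni i W0 WE e eS}=> [|h] er x0 h0 n0 /=.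
  rewrite mulr0n add0r addr0. field; by rewrite C0 x0 h0 n0.
rewrite addnS -addSn coef_pade_ode_sol addSnnS -er factS !natrM -(mulr_natr (_ / _) h.+1).
have := natr_fact_neq0 h; have := natrS_neq0 h; move: (h.+1%:R : rat) (h`!%:R : rat) => y z y0 z0.
by field; rewrite C0 x0 n0 y0 z0.
Qed.

Lemma derivn_pade_ode n k (Y : {poly rat}) :
  ((1 + 'X) * Y^`() - Y *+ n)^`(k) =
  (1 + 'X) * Y^`(k.+1) + Y^`(k) *+ k - Y^`(k) *+ n.
Proof.
elim: k => [|k IH]; first by rewrite !derivn0 derivn1 mulr0n addr0.
rewrite derivnS IH derivB derivD !derivMn -!derivnS derivM derivD -[1]/(1%:P) derivC derivX.
rewrite -derivnS add0r mul1r mulrSr; ring.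
Qed.

Lemma derivn_mul_XsubCXn_root n k a (G : {poly rat}) : (k < n)%N ->
  (G * ('X - a%:P) ^+ n)^`(k).[a] = 0.
Proof.
elim: k n G => [|k IH] n G; case: n => // n kn.
  by rewrite derivn0 hornerM horner_exp hornerXsubC subrr expr0n mulr0.
rewrite derivSn derivM deriv_exp derivXsubC mul1r /=.
have -> : G^`() * ('X - a%:P) ^+ n.+1 + G * (('X - a%:P) ^+ n *+ n.+1)
  = (G^`() * ('X - a%:P) + G *+ n.+1) * ('X - a%:P) ^+ n.
  by rewrite [RHS]mulrDl exprS -mulrA mulrnAr mulrnAl.
exact: IH.
Qed.

Lemma derivn_mul_XsubCXn e a (G : {poly rat}) :
  (G * ('X - a%:P) ^+ e)^`(e).[a] = G.[a] *+ e`!.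
Proof.
elim: e G => [|e IH] G; first by rewrite derivn0 mulr1 mulr1n.
rewrite derivSn derivM deriv_exp derivXsubC mul1r /=.
have -> : G^`() * ('X - a%:P) ^+ e.+1 + G * (('X - a%:P) ^+ e *+ e.+1)
  = (G^`() * ('X - a%:P) + G *+ e.+1) * ('X - a%:P) ^+ e.
  by rewrite [RHS]mulrDl exprS -mulrA mulrnAr mulrnAl.
by rewrite IH hornerD hornerM hornerXsubC subrr mulr0 add0r hornerMn -mulrnA factS mulnC.
Qed.

Lemma dvdp_XsubCXn_derivn e a (Y : {poly rat}) :
  (forall k, (k < e)%N -> Y^`(k).[a] = 0) -> (('X - a%:P) ^+ e %| Y)%R.
Proof.
elim: e => [|e IH] h; first by rewrite expr0 dvd1p.
have /dvdpP[G YE] := IH (fun k ke => h k (ltnW ke)).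
have := h e (leqnn _); rewrite YE derivn_mul_XsubCXn => /eqP.
rewrite mulrn_eq0 eqn0Ngt fact_gt0 /= => /factor_theorem[q ->].
by rewrite -mulrA -exprS dvdp_mull.
Qed.

Lemma dvdp_prod_XsubCXn e (s : seq rat) (Y : {poly rat}) : uniq s ->
  (forall a, a \in s -> (('X - a%:P) ^+ e %| Y)%R) ->
  (\prod_(a <- s) ('X - a%:P) ^+ e %| Y)%R.
Proof.
elim: s => [|a s IH]; first by rewrite big_nil dvd1p.
move=> /= /andP[as_ us] h; rewrite big_cons Gauss_dvdp.
  by rewrite h ?mem_head//= IH// => b bs; apply: h; rewrite inE bs orbT.
rewrite prodrXl; apply/coprimep_expl/coprimep_expr.
by rewrite coprimep_sym coprimep_XsubC root_prod_XsubC.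
Qed.

(** For k < n the k-th derivative of the equation at a reads (1+a) Y^(k+1)(a) = (n-k) Y^(k)(a).
    Hence the vanishing of the n-th derivative descends to all lower ones. *)
Lemma pade_ode_root n a (Y W : {poly rat}) :
  (1 + 'X) * Y^`() - Y *+ n = W -> (('X - a%:P) ^+ n %| W)%R ->
  Y^`(n).[a] = 0 -> (('X - a%:P) ^+ n.+1 %| Y)%R.
Proof.
move=> ode /dvdpP[G WE] Yn; apply: dvdp_XsubCXn_derivn.
suff h d : (d <= n)%N -> Y^`(n - d).[a] = 0.
  by move=> k kn; rewrite -(subKn (_ : (k <= n)%N)) ?h//; lia.
elim: d => [|d IH] dn; first by rewrite subn0.
have := derivn_pade_ode n (n - d.+1) Y; rewrite ode WE.
move=> /(congr1 (fun p => p.[a])); rewrite derivn_mul_XsubCXn_root; last lia.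
rewrite !hornerE !hornerMn (_ : (n - d.+1).+1 = (n - d)%N); last lia.
rewrite IH; last lia.
rewrite mulr0 add0r -opprB -mulrnBr; last lia.
move=> /esym/eqP; rewrite oppr_eq0 mulrn_eq0 => /orP[|/eqP->//]; lia.
Qed.

Lemma pade_nondegenerate n (s : seq rat) (g : {poly rat}) :
  uniq s -> 0 \notin s -> (size g <= (size s).+1)%N ->
  let P := ('X^n * (\prod_(a <- s) ('X - a%:P) ^+ n * g))^`N(n) in
  P.[-1] = 0 -> (forall a, a \in s -> log_form a P = 0) -> g = 0.
Proof.
move=> us s0 sg P P1 Plog; set W := 'X^n * _ in P P1 Plog.
have W0 i : (i < n)%N -> W`_i = 0 by move=> hi; rewrite /W coefXnM hi.
have /factor_theorem[Q PE] : root P (-1) by apply/eqP.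
pose Y := pade_ode_sol n Q.
have ode : (1 + 'X) * Y^`() - Y *+ n = W by exact: pade_ode_solE.
(* The root at 0 comes for free, since X^n divides W and [primitive Q] vanishes at 0. At the other
   points it comes from the vanishing of [log_form]. *)
have Ydvd : (\prod_(a <- 0 :: s) ('X - a%:P) ^+ n.+1 %| Y)%R.
  apply: dvdp_prod_XsubCXn; first by rewrite /= s0.
  move=> a; rewrite inE => ha; apply: (pade_ode_root ode).
    case/predU1P: ha => [->|ha]; first by rewrite subr0 dvdp_mulr.
    by rewrite /W (perm_big _ (perm_to_rem ha)) big_cons /= -!mulrA dvdp_mull// dvdp_mulr.
  rewrite nderivn_def nderivn_pade_ode_sol hornerMn.
  suff -> : (primitive Q).[a] = 0 by rewrite mul0rn.
  case/predU1P: ha => [->|ha].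
    by rewrite horner_coef0 coef_primitive invr0 mulr0.
  by apply/eqP; rewrite -oppr_eq0 -log_formMXaddC -PE Plog.
have g0 : size W = 0%N -> g = 0.
  move/eqP; rewrite size_poly_eq0 /W !mulf_eq0 expf_eq0 polyX_eq0 andbF /=.
  rewrite prodf_seq_eq0 => /orP[/hasP[a _]|/eqP//].
  by rewrite /= expf_eq0 polyXsubC_eq0 andbF.
have sizeM k : (size (\prod_(a <- s) ('X - a%:P) ^+ k)%R = (size s * k).+1)%N.
  rewrite prodrXl; have := size_exp (\prod_(a <- s) ('X - a%:P)) k.
  rewrite size_prod_XsubC /= => <-; rewrite prednK// lt0n size_poly_eq0.
  by rewrite expf_neq0// monic_neq0// monic_prod_XsubC.
have [Y0|Y0] := eqVneq Y 0.
  by apply: g0; rewrite -ode Y0 linear0 mulr0 mul0rn subr0 size_poly0.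
have Q0 : Q != 0.
  apply: contraNneq Y0 => Q0; apply/eqP/polyP => i.
  by rewrite coef_poly Q0 !coef0 !mul0r !if_same.
have sP : size P = (size Q).+1.
  by rewrite PE size_Mmonic ?monicXsubC// size_XsubC addn2.
have sPW : (size P <= size W - n)%N.
  apply/leq_sizeP => j hj; by rewrite coef_nderivn nth_default ?mul0rn// -leq_subLR.
(* With m = [size s], deg g <= m gives deg P <= mn + m, so deg Q <= mn + m - 1 and deg Y <= mn + m +
   n. This is one less than the degree (m+1)(n+1) of the divisor. *)
have := dvdp_leq Y0 Ydvd; rewrite big_cons.
rewrite size_Mmonic; first last.
- by rewrite prodrXl monic_exp// monic_prod_XsubC.
- by rewrite expf_eq0 polyXsubC_eq0 andbF.
rewrite sizeM size_exp_XsubC => h1.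
have h2 : (size Y <= size Q + n.+1)%N by exact: size_poly.
have h3 : (size W <= n + (size s * n + size g))%N.
  rewrite /W (leq_trans (size_polyMleq _ _))// size_polyXn /= leq_add2l.
  by rewrite (leq_trans (size_polyMleq _ _))// sizeM.
move: h1 h2 h3 sPW sP sg.
move: (size Y) (size Q) (size W) (size P) (size g) (size s) => y q w p' g' k.
rewrite mulnS; move: (k * n)%N => t *; exfalso; lia.
Qed.

(** * Orthogonality and the remainder *)

Lemma primitiveB f g : primitive (f - g) = primitive f - primitive g.
Proof. by apply/polyP => i; rewrite coefB !coef_primitive coefB mulrBl. Qed.

Lemma primitiveMn f n : primitive (f *+ n) = primitive f *+ n.
Proof. by apply/polyP => i; rewrite coefMn !coef_primitive coefMn mulrnAl. Qed.

Lemma primitive_deriv f : primitive f^`() = f - (f.[0])%:P.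
Proof.
apply/polyP => i; rewrite coef_primitive coefB coefC horner_coef0.
case: i => [|i] /=; first by rewrite invr0 mulr0 subrr.
rewrite coef_deriv subr0 -[f`_i.+1 *+ _]mulr_natr mulfK ?pnatr_eq0 ?natrS_neq0 //.
Qed.

(** Repeated integration by parts: the derivatives of W of order below n vanish at both endpoints 0
    and a, and fewer than n steps exhaust X^i. *)
Lemma primitive_orthogonal n a (W : {poly rat}) i :
  ('X^n %| W)%R -> (('X - a%:P) ^+ n %| W)%R -> (i < n)%N ->
  (primitive ('X^i * W^`N(n))).[a] = 0.
Proof.
move=> /dvdpP[F WF] /dvdpP[G WG] hin.
have Wa k : (k < n)%N -> W^`(k).[a] = 0.
  by move=> kn; rewrite WG derivn_mul_XsubCXn_root.
have W0 k : (k < n)%N -> W^`(k).[0] = 0.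
  by move=> kn; rewrite WF -['X]subr0 derivn_mul_XsubCXn_root.
have h j k : (j < k <= n)%N -> (primitive ('X^j * W^`(k))).[a] = 0.
  elim: j k => [|j IH] [//|k] /andP[jk kn].
    by rewrite mul1r derivnS primitive_deriv hornerD hornerN hornerC Wa// W0// subrr.
  have -> : 'X^(j.+1) * W^`(k.+1) = ('X^(j.+1) * W^`(k))^`() - ('X^j * W^`(k)) *+ j.+1.
    by rewrite derivM -derivnS derivXn mulrnAl addrC addKr.
  rewrite primitiveB primitiveMn primitive_deriv !hornerE hornerMn.
  rewrite IH ?mul0rn; last lia.
  by rewrite Wa ?W0 ?mulr0 ?subrr.
have := h i n; rewrite hin leqnn => /(_ isT).
rewrite nderivn_def mulrnAr primitiveMn hornerMn => /eqP.
by rewrite mulrn_eq0 eqn0Ngt fact_gt0 => /eqP.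
Qed.

(** The left side is the double sum over h <= k < K. Its part on a diagonal k = h + i is (-1)^i
    times the integral of x^i P over [0, a], which is 0 for i < n. *)
Lemma log_form_remainder n L K a (P : {poly rat}) :
  (size P <= L.+1)%N -> (L + n <= K)%N ->
  (forall i, (i < n)%N -> (primitive ('X^i * P)).[a] = 0) ->
  P.[-1] * log_sum a K - log_form a P =
  \sum_(h < L.+1) \sum_(h + n <= k < K)
     (-1) ^+ h * P`_h * ((-1) ^+ k * a ^+ k.+1 / k.+1%:R).
Proof.
move=> sP LK orth.
rewrite (horner_coef_wide _ sP) (log_form_wide a sP) mulr_suml -sumrB.
pose t (h : nat) k := (-1) ^+ h * P`_h * ((-1) ^+ k * a ^+ k.+1 / k.+1%:R).
have E (h : 'I_L.+1) : P`_h * (-1) ^+ h * log_sum a K - (-1) ^+ h * P`_h * log_sum a h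
   = \sum_(h <= k < h + n) t h k + \sum_(h + n <= k < K) t h k.
  have hK : (h + n <= K)%N by have := ltn_ord h; lia.
  rewrite -big_cat_nat ?leq_addr//= -[RHS](addKr (\sum_(0 <= k < h) t h k)).
  rewrite -big_cat_nat//=; last lia.
  by rewrite [P`_h * _]mulrC /log_sum !mulr_sumr !big_mkord addrC.
rewrite (eq_bigr _ (fun h _ => E h)) big_split /= [X in X + _](_ : _ = 0) ?add0r//.
rewrite (eq_bigr (fun h : 'I_L.+1 => \sum_(i < n) t h (h + i)%N)); last first.
  by move=> h _; rewrite -{1}[h : nat]add0n big_addn addKn big_mkord; apply: eq_bigr => i _; rewrite addnC.
rewrite exchange_big /= big1// => i _.
transitivity ((-1) ^+ i * (primitive ('X^i * P)).[a]); last by rewrite orth// mulr0.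
have sz : (size (primitive ('X^i * P)) <= i + L.+2)%N.
  rewrite (leq_trans (size_poly _ _))//.
  have := size_polyMleq ('X^i) P; rewrite size_polyXn; lia.
rewrite (horner_coef_wide _ sz) big_split_ord /= [X in _ * (X + _)]big1 => [|k _]; last first.
  rewrite coef_primitive coefXnM.
  by case: (nat_of_ord k) (ltn_ord k) => [|j] ji /=; rewrite ?invr0 ?mulr0 ?mul0r// (ltnW ji) !mul0r.
rewrite add0r [in RHS]big_ord_recl /= addn0 coef_primitive coefXnM.
rewrite (_ : (if _ then _ else _) / _ = 0); last first.
  by case: (nat_of_ord i) => [|k] /=; rewrite ?invr0 ?mulr0// leqnn mul0r.
rewrite mul0r add0r mulr_sumr; apply: eq_bigr => k _.
rewrite coef_primitive /bump /= add1n addnS coefXnM /= ltnNge leq_addr /= addKn.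
have e : (-1) ^+ k * (-1) ^+ k = 1 :> rat by rewrite -expr2 sqrr_sign.
rewrite /t addnC exprD.
transitivity (((-1) ^+ k * (-1) ^+ k) * ((-1) ^+ i * (P`_k * a ^+ (i + k).+1 / (i + k).+1%:R))).
  by ring.
by rewrite e; ring.
Qed.

(** * Estimates for the Pade approximants *)

Lemma coef_XsubCM (b : rat) (G : {poly rat}) h :
  (('X - b%:P) * G)`_h = (if h is h'.+1 then G`_h' else 0) - b * G`_h.
Proof. by rewrite mulrBl coefB coefCM coefXM; case: h. Qed.

Lemma coef_prod_XsubC_gt (r : seq rat) h : (size r < h)%N ->
  (\prod_(b <- r) ('X - b%:P))`_h = 0.
Proof. by move=> rh; rewrite nth_default// size_prod_XsubC. Qed.

(** Up to sign the coefficient is the elementary symmetric function of degree [size r - h] in the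
    roots. This explains the exponent here and in the next two bounds. *)
Lemma coef_prod_XsubC_int (q : rat) (r : seq rat) h :
  {in r, forall b, q * b \is a Num.int} ->
  q ^+ (size r - h) * (\prod_(b <- r) ('X - b%:P))`_h \is a Num.int.
Proof.
elim: r h => [|b r IH] h hr; first by rewrite big_nil coef1 expr0 mul1r; case: h.
have {}IH h' := IH h' (fun c cr => hr c (@mem_behead _ (b :: r) c cr)).
rewrite big_cons coef_XsubCM /= mulrBr; set G := \prod_(_ <- _) _ in IH *.
have hb : q * b \is a Num.int by apply: hr; rewrite mem_head.
apply: rpredB; first by case: h => [|h]; rewrite ?mulr0 ?rpred0// subSS.
have [hr'|rh] := leqP h (size r).
  by rewrite subSn// exprS mulrACA rpredM.
by rewrite coef_prod_XsubC_gt// !mulr0 rpred0.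
Qed.

Lemma coef_prod_XsubC_norm (M : rat) (r : seq rat) h : 0 <= M ->
  {in r, forall b, `|b| <= M} ->
  `|(\prod_(b <- r) ('X - b%:P))`_h| <= 'C(size r, h)%:R * M ^+ (size r - h).
Proof.
move=> M0; elim: r h => [|b r IH] h hr.
  by rewrite big_nil coef1 expr0 mulr1; case: h {hr} => [|h]; rewrite ?normr1 ?normr0.
have {}IH h' := IH h' (fun c cr => hr c (@mem_behead _ (b :: r) c cr)).
rewrite big_cons coef_XsubCM /=; set G := \prod_(_ <- _) _ in IH *.
have hb : `|b| <= M by apply: hr; rewrite mem_head.
have E : `|b * G`_h| <= 'C(size r, h)%:R * M ^+ ((size r).+1 - h).
  have [hr'|rh] := leqP h (size r).
    by rewrite subSn// exprS normrM mulrCA ler_pM.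
  by rewrite coef_prod_XsubC_gt// mulr0 normr0 mulr_ge0// exprn_ge0.
case: h E => [|h] E; first by rewrite sub0r normrN bin0 (le_trans E)// bin0.
by rewrite (le_trans (ler_normB _ _))// binS natrD mulrDl addrC lerD.
Qed.

Lemma coef_prod_XsubC_padic p (A : rat) (r : seq rat) h : 0 <= A ->
  {in r, forall b, padic_abs p b <= A} ->
  padic_abs p (\prod_(b <- r) ('X - b%:P))`_h <= A ^+ (size r - h).
Proof.
move=> A0; elim: r h => [|b r IH] h hr.
  rewrite big_nil coef1 expr0; case: h => [|h] /=; first by rewrite padic_abs1.
  by rewrite padic_abs0.
have {}IH h' := IH h' (fun c cr => hr c (@mem_behead _ (b :: r) c cr)).
rewrite big_cons coef_XsubCM /=; set G := \prod_(_ <- _) _ in IH *.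
have hb : padic_abs p b <= A by apply: hr; rewrite mem_head.
rewrite (le_trans (padic_absD _ _ _))// padic_absN ge_max; apply/andP; split.
  by case: h => [|h]; rewrite ?padic_abs0 ?exprn_ge0// subSS.
have [hr'|rh] := leqP h (size r).
  by rewrite subSn// exprS padic_absM ler_pM ?padic_abs_ge0.
by rewrite coef_prod_XsubC_gt// mulr0 padic_abs0 exprn_ge0.
Qed.

Lemma padic_abs_natr p n : (0 < n)%N ->
  padic_abs p n%:R = p%:R ^- (logn p n).
Proof.
move=> n0; rewrite -[n%:R]divr1 -[1]/(1%:Q) -[n%:R]/((Posz n)%:Q) padic_absE ?eqz_nat -?lt0n//.
by rewrite /= logn1 sub0r -exprnN.
Qed.

Lemma padic_abs_natr_ge p n : (0 < n)%N -> n%:R^-1 <= padic_abs p n%:R.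
Proof.
move=> n0; rewrite padic_abs_natr// -natrX lef_pV2 ?posrE ?ltr0n ?(dvdn_gt0 n0 (pfactor_dvdnn _ _))//.
by rewrite ler_nat dvdn_leq ?pfactor_dvdnn.
Qed.

(** The p-adic Liouville inequality: the power of p dividing a nonzero integer is at most its
    absolute value. *)
Lemma padic_abs_int_ge p z : z \is a Num.int -> z != 0 -> `|z|^-1 <= padic_abs p z.
Proof.
move=> /intrP[k ->]; rewrite intr_eq0 => k0.
have [n [n0 [e|e]]] : exists n, (0 < n)%N /\ (k = Posz n \/ k = - Posz n).
  by exists `|k|%N; split; lia.
  by rewrite e -[(Posz n)%:~R]/(n%:R) normr_nat padic_abs_natr_ge.
by rewrite e intrN padic_absN normrN -[(Posz n)%:~R]/(n%:R) normr_nat padic_abs_natr_ge.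
Qed.

Lemma padic_abs_natr_le1 p n : padic_abs p n%:R <= 1.
Proof.
have [->|n0] := posnP n; first by rewrite padic_abs0.
have d : (0 < p ^ logn p n)%N by rewrite (dvdn_gt0 n0)// pfactor_dvdnn.
by rewrite padic_abs_natr// -natrX invf_le1 ?ltr0n// ler1n.
Qed.

Lemma padic_abs_int_le1 p z : z \is a Num.int -> padic_abs p z <= 1.
Proof.
move=> /intrP[k ->]; have [e|e] : k = Posz `|k|%N \/ k = - Posz `|k|%N by lia.
  by rewrite e -[(Posz _)%:~R]/(_%:R) padic_abs_natr_le1.
by rewrite e intrN padic_absN -[(Posz _)%:~R]/(_%:R) padic_abs_natr_le1.
Qed.

Lemma padic_absX p x n : padic_abs p (x ^+ n) = padic_abs p x ^+ n.
Proof. by elim: n => [|n IH]; rewrite ?expr0 ?padic_abs1// !exprS padic_absM IH. Qed.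

Lemma padic_abs_sign p n : padic_abs p ((-1) ^+ n) = 1.
Proof. by rewrite padic_absX padic_absN padic_abs1 expr1n. Qed.

Lemma padic_abs_sum (I : Type) (s : seq I) (P : pred I) (F : I -> rat) p c : 0 <= c ->
  (forall i, P i -> padic_abs p (F i) <= c) ->
  padic_abs p (\sum_(i <- s | P i) F i) <= c.
Proof.
move=> c0 Fc; apply: (big_ind (fun x => padic_abs p x <= c)) => // x y hx hy.
by rewrite (le_trans (padic_absD _ _ _))// ge_max hx.
Qed.

(** Consecutive terms have ratio A (l+2)/(l+1) <= 2A <= 1. As |a^(k+1)/(k+1)|_p is at most (k+1)
    A^(k+1), a tail of the logarithm is bounded by its first term. *)
Lemma mulr_exp_antitone (A : rat) k l : 0 <= A -> A <= 1 / 2 -> (k <= l)%N ->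
  l.+1%:R * A ^+ l.+1 <= k.+1%:R * A ^+ k.+1.
Proof.
move=> A0 A2; elim: l => [|l IH]; first by rewrite leqn0 => /eqP->.
rewrite leq_eqVlt => /predU1P[->//|]; rewrite ltnS => /IH; apply: le_trans.
rewrite exprS mulrA ler_wpM2r ?exprn_ge0//.
have l1 : (l.+2%:R : rat) = l.+1%:R + 1 by rewrite natr1.
have : 1 <= (l.+1%:R : rat) by rewrite ler1n.
rewrite l1; nra.
Qed.

(** The list [r] carries multiplicities: with every a_j repeated n times, the product is Om. *)
Definition pade n mu (r : seq rat) : {poly rat} :=
  ('X^n * (\prod_(b <- r) ('X - b%:P) * 'X^mu))^`N(n).

Lemma coef_pade n mu r h : (pade n mu r)`_h =
  if (h < mu)%N then 0 else (\prod_(b <- r) ('X - b%:P))`_(h - mu) *+ 'C(n + h, n).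
Proof.
rewrite coef_nderivn coefXnM ltnNge leq_addr /= addKn coefMXn.
by case: ifP => //; rewrite mul0rn.
Qed.

Lemma size_pade n mu r : (size (pade n mu r) <= (size r + mu).+1)%N.
Proof.
apply/leq_sizeP => h hh; rewrite coef_pade; case: ifP => // _.
rewrite coef_prod_XsubC_gt ?mul0rn//; lia.
Qed.

Section PadeBounds.
Variables (n mu : nat) (r : seq rat).
Local Notation P := (pade n mu r).
Local Notation L := (size r + mu)%N.

(** The coefficient P_h has size at most A^(L-h), so a term of the remainder has size at most (k+1)
    A^(L-h+k+1). Enlarging k+1 to L-h+k+1 makes [mulr_exp_antitone] applicable, and k >= h + n gives
    the exponent L+n+1. *)
Lemma pade_remainder_padic p A a K : 0 <= A -> A <= 1 / 2 ->
  {in r, forall b, padic_abs p b <= A} -> padic_abs p a <= A ->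
  (('X - a%:P) ^+ n %| \prod_(b <- r) ('X - b%:P))%R -> (L + n <= K)%N ->
  padic_abs p (P.[-1] * log_sum a K - log_form a P) <=
    (L + n).+1%:R * A ^+ (L + n).+1.
Proof.
move=> A0 A2 rA aA adv LK.
rewrite (@log_form_remainder n L)//; first last.
- move=> i hi; apply: primitive_orthogonal => //; first exact: dvdp_mulr.
  by rewrite dvdp_mull// dvdp_mulr.
- exact: size_pade.
have c0 : 0 <= (L + n).+1%:R * A ^+ (L + n).+1 by rewrite mulr_ge0// exprn_ge0.
apply: padic_abs_sum => // h _; rewrite big_seq_cond.
apply: padic_abs_sum => // k; rewrite andbT mem_index_iota => /andP[hk _].
have hL := ltn_ord h.
have Ph : padic_abs p P`_h <= A ^+ (L - h).
  rewrite coef_pade; case: ltnP => hmu; first by rewrite padic_abs0 exprn_ge0.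
  rewrite -mulr_natr padic_absM -[leRHS]mulr1 ler_pM ?padic_abs_ge0 ?padic_abs_natr_le1//.
  by rewrite (le_trans (coef_prod_XsubC_padic _ A0 rA))// subnBA.
rewrite !padic_absM !padic_abs_sign !mul1r padic_absX padic_absV.
have kV : (padic_abs p k.+1%:R)^-1 <= k.+1%:R.
  by rewrite -[leRHS]invrK lef_pV2 ?posrE ?invr_gt0 ?padic_abs_gt0 ?padic_abs_natr_ge ?pnatr_eq0.
apply: (@le_trans _ _ (A ^+ (L - h) * (A ^+ k.+1 * k.+1%:R))).
  rewrite ler_pM ?padic_abs_ge0 ?mulr_ge0 ?exprn_ge0 ?invr_ge0 ?padic_abs_ge0//.
  by rewrite ler_pM ?exprn_ge0 ?invr_ge0 ?padic_abs_ge0// lerXn2r ?nnegrE ?padic_abs_ge0.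
rewrite mulrA -exprD addnS mulrC.
apply: (@le_trans _ _ ((L - h + k).+1%:R * A ^+ (L - h + k).+1)).
  by rewrite ler_wpM2r ?exprn_ge0// ler_nat; lia.
by apply: mulr_exp_antitone => //; lia.
Qed.

(** In each term the coefficient of P has degree L - h in the roots and k+1 <= h powers of a follow,
    so that L factors q suffice. The denominator k+1 is at most L and divides the lcm. *)
Lemma log_form_pade_int (q a : rat) K : q \is a Num.int -> q * a \is a Num.int ->
  {in r, forall b, q * b \is a Num.int} -> (L <= K)%N ->
  (lcm_upto K)%:R * q ^+ K * log_form a P \is a Num.int.
Proof.
move=> qZ aZ rZ LK; rewrite (log_form_wide a (size_pade n mu r)) mulr_sumr.
apply: rpred_sum => h _; rewrite /log_sum !mulr_sumr; apply: rpred_sum => k _.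
have hL := ltn_ord h; have kh := ltn_ord k.
rewrite coef_pade; case: ltnP => hmu; first by rewrite mulr0 mul0r mulr0 rpred0.
have /dvdnP[c cE] : (k.+1 %| lcm_upto K)%N by apply: dvdn_lcm_upto => /=; lia.
rewrite cE natrM; set g := _`_(h - mu); have := coef_prod_XsubC_int (h - mu) rZ.
rewrite -/g => gZ.
have -> : K = (size r - (h - mu) + (k.+1 + (K - (size r - (h - mu) + k.+1))))%N by lia.
set e := (size r - _)%N; set f := (K - _)%N; rewrite !exprD -[g *+ _]mulr_natr.
have -> : c%:R * k.+1%:R * (q ^+ e * (q ^+ k.+1 * q ^+ f)) *
    ((-1) ^+ h * (g * 'C(n + h, n)%:R) * ((-1) ^+ k * a ^+ k.+1 / k.+1%:R)) =
  c%:R * (-1) ^+ h * (-1) ^+ k * 'C(n + h, n)%:R * (q ^+ e * g) * (q * a) ^+ k.+1 * q ^+ f.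
  rewrite exprMn; move: (k.+1%:R : rat) (natrS_neq0 k) => x x0; by field.
apply: rpredM; last exact: rpredX.
apply: rpredM; last exact: rpredX.
apply: rpredM => //; by rewrite !(rpredM, rpredX, rpredN, rpred1, rpred_nat).
Qed.

Lemma horner_pade_int (q : rat) K : q \is a Num.int ->
  {in r, forall b, q * b \is a Num.int} -> (L <= K)%N ->
  (lcm_upto K)%:R * q ^+ K * P.[-1] \is a Num.int.
Proof.
move=> qZ rZ LK; rewrite (horner_coef_wide _ (size_pade n mu r)) mulr_sumr.
apply: rpred_sum => h _; have hL := ltn_ord h.
rewrite coef_pade; case: ltnP => hmu; first by rewrite mul0r mulr0 rpred0.
set g := _`_(h - mu); have := coef_prod_XsubC_int (h - mu) rZ.
rewrite -/g => gZ.
have -> : q ^+ K = q ^+ (size r - (h - mu)) * q ^+ (K - (size r - (h - mu))).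
  by rewrite -exprD; congr (_ ^+ _); lia.
set e := (size r - _)%N; set f := (K - _)%N; rewrite -[g *+ _]mulr_natr.
have -> : (lcm_upto K)%:R * (q ^+ e * q ^+ f) * (g * 'C(n + h, n)%:R * (-1) ^+ h) =
  (lcm_upto K)%:R * (-1) ^+ h * 'C(n + h, n)%:R * (q ^+ e * g) * q ^+ f by ring.
apply: rpredM; last exact: rpredX.
apply: rpredM => //.
by rewrite !(rpredM, rpredX, rpredN, rpred1, rpred_nat).
Qed.

(* C(k, l) r^l <= (1 + r)^k at r = 1/2; compared with r = 1 this trades a factor
   3/2 per step for (5/6)^m, which pays for the weak bound on lcm_upto. *)
Lemma bin_le_exp (k l : nat) : 'C(k, l)%:R <= 2 ^+ l * (3 / 2) ^+ k :> rat.
Proof.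
have [kl|kl] := ltnP k l; first by rewrite bin_small// mulr_ge0 ?exprn_ge0.
have -> : 3 / 2 = 1 + 1 / 2 :> rat by lra.
rewrite -ler_pdivrMl ?exprn_gt0// [leRHS]exprDn.
rewrite (bigD1 (inord l)) //= inordK ?ltnS// expr1n mul1r -[leLHS]addr0 lerD//.
  by rewrite -[leRHS]mulr_natr div1r exprVn.
by apply: sumr_ge0 => i _; rewrite mulrn_wge0// mulr_ge0 ?exprn_ge0.
Qed.

(** A common bound for |P(-1)| and |T_j(P)|: the weight M^(h+1)/(M-1) dominates both 1 and the
    partial sums of the logarithm. At h = mu + i, [bin_le_exp] gives the factor 3^n (3/2)^(mu+i),
    and the sum of (3/2)^i C(size r, i) is (5/2)^(size r). *)
Lemma pade_coef_sum (M : rat) : 1 < M -> {in r, forall b, `|b| <= M} ->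
  \sum_(h < L.+1) `|P`_h| * (M ^+ h.+1 / (M - 1)) <=
    M ^+ L * (M / (M - 1)) * (3 ^+ n * (3 / 2) ^+ mu * (5 / 2) ^+ size r).
Proof.
move=> M1 rM; have M0 : 0 <= M by lra.
have MM : 0 <= M / (M - 1) by rewrite divr_ge0//; lra.
rewrite -addSn addnC big_split_ord /= big1 ?add0r => [|h _]; last first.
  by rewrite coef_pade ltn_ord normr0 mul0r.
have -> : (5 / 2) ^+ size r = \sum_(i < (size r).+1) (3 / 2) ^+ i *+ 'C(size r, i) :> rat.
  rewrite (_ : 5 / 2 = 1 + 3 / 2); last by lra.
  by rewrite exprDn; apply: eq_bigr => i _; rewrite expr1n mul1r.
rewrite !mulr_sumr; apply: ler_sum => i _.
rewrite coef_pade ltnNge leq_addr /= addKn normrMn.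
have hi := ltn_ord i; set g := `|_`_i|.
have gM : g <= 'C(size r, i)%:R * M ^+ (size r - i) by exact: coef_prod_XsubC_norm.
have -> : M ^+ (size r + mu) = M ^+ (size r - i) * M ^+ (mu + i).
  by rewrite -exprD; congr (_ ^+ _); lia.
rewrite -[g *+ _]mulr_natr exprS.
have bl := bin_le_exp (n + (mu + i)) n.
have e3 : 2 ^+ n * (3 / 2) ^+ (n + (mu + i)) = 3 ^+ n * (3 / 2) ^+ mu * (3 / 2) ^+ i :> rat.
  by rewrite !exprD mulrA -exprMn (_ : 2 * (3 / 2) = 3) ?mulrA.
rewrite e3 in bl.
apply: (@le_trans _ _ ('C(size r, i)%:R * M ^+ (size r - i) *
    (3 ^+ n * (3 / 2) ^+ mu * (3 / 2) ^+ i) * (M * M ^+ (mu + i) / (M - 1)))).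
  rewrite ler_wpM2r ?ler_pM ?normr_ge0 ?ler0n// mulrAC mulr_ge0// exprn_ge0//.
rewrite -(mulr_natr ((3 / 2) ^+ i)) le_eqVlt; apply/orP; left; apply/eqP; ring.
Qed.

Lemma pade_norm (M : rat) : 1 < M -> {in r, forall b, `|b| <= M} ->
  `|P.[-1]| <= M ^+ L * (M / (M - 1)) * (3 ^+ n * (3 / 2) ^+ mu * (5 / 2) ^+ size r).
Proof.
move=> M1 rM; apply: le_trans (pade_coef_sum M1 rM).
rewrite (horner_coef_wide _ (size_pade n mu r)) (le_trans (ler_norm_sum _ _ _))//.
apply: ler_sum => h _; rewrite normrM normrX normrN normr1 expr1n.
rewrite ler_wpM2l// ler_pdivlMr; last by lra.
have : 1 <= M ^+ h by apply: exprn_ege1; lra.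
by rewrite exprS; nra.
Qed.

Lemma log_sum_norm (M a : rat) h : 1 < M -> `|a| <= M ->
  `|log_sum a h| <= M ^+ h.+1 / (M - 1).
Proof.
move=> M1 aM; elim: h => [|h IH].
  by rewrite /log_sum big_ord0 normr0 divr_ge0 ?exprn_ge0//; lra.
rewrite /log_sum big_ord_recr /= -/(log_sum a h).
have -> : M ^+ h.+2 / (M - 1) = M ^+ h.+1 / (M - 1) + M ^+ h.+1.
  by rewrite [M ^+ h.+2]exprS; field; lra.
rewrite (le_trans (ler_normD _ _))// lerD// !normrM normrX normrN normr1 expr1n mul1r.
rewrite -[leRHS]mulr1 ler_pM ?normr_ge0// ?normrX ?lerXn2r ?nnegrE//; first lra.
by rewrite ger0_norm ?invr_ge0// invf_le1// ler1n.
Qed.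

Lemma log_form_pade_norm (M a : rat) : 1 < M -> {in r, forall b, `|b| <= M} -> `|a| <= M ->
  `|log_form a P| <= M ^+ L * (M / (M - 1)) * (3 ^+ n * (3 / 2) ^+ mu * (5 / 2) ^+ size r).
Proof.
move=> M1 rM aM; apply: le_trans (pade_coef_sum M1 rM).
rewrite (log_form_wide a (size_pade n mu r)) (le_trans (ler_norm_sum _ _ _))//.
apply: ler_sum => h _; rewrite !normrM normrX normrN normr1 expr1n mul1r.
by rewrite ler_wpM2l// log_sum_norm.
Qed.

End PadeBounds.

(** * The approximants as a nonsingular square system *)

Section Approximants.
Variables (m n : nat) (alpha : 'I_m -> rat).

Definition roots_seq : seq rat := flatten [seq nseq n (alpha i) | i <- enum 'I_m].

Lemma size_roots_seq : size roots_seq = (m * n)%N.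
Proof.
rewrite size_flatten /shape -map_comp sumnE big_map big_enum /=.
under eq_bigr do rewrite size_nseq.
by rewrite sum_nat_const card_ord.
Qed.

Lemma prod_roots_seq :
  \prod_(b <- roots_seq) ('X - b%:P) = \prod_(b <- codom alpha) ('X - b%:P) ^+ n.
Proof.
rewrite big_flatten big_map /codom /image_mem big_map; apply: eq_bigr => i _.
by rewrite big_nseq iter_mulr_1.
Qed.

Lemma mem_roots_seq (T : rat -> Prop) :
  (forall i, T (alpha i)) -> forall b, b \in roots_seq -> T b.
Proof. by move=> h b /flattenP[s /mapP[i _ ->]] /nseqP[-> _]. Qed.

(** Indexed like [lambda]: the common multiplier P(-1) sits at index 0 and the T_j(P) at the others,
    so that N is a scalar product up to the denominator. *)
Definition approx (mu : nat) (j : 'I_m.+1) : rat :=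
  if unlift ord0 j is Some i then log_form (alpha i) (pade n mu roots_seq)
  else (pade n mu roots_seq).[-1].

(** If every sum vanished, [lambda] would be a relation between the columns of the square matrix
    [approx]. A relation between its rows would follow, whose entries are the coefficients of the
    polynomial g excluded by [pade_nondegenerate]. *)
Lemma approx_nondegenerate (lambda : 'I_m.+1 -> int) :
  injective alpha -> (forall i, alpha i != 0) -> (exists i, lambda i != 0) ->
  exists mu : 'I_m.+1, \sum_j (lambda j)%:~R * approx mu j != 0.
Proof.
move=> ainj a0 [i0 li0]; apply/existsP; apply: contraT; rewrite negb_exists.
move=> /forallP h0.
pose E := \matrix_(mu < m.+1, j < m.+1) approx mu j.
have : \det E^T = 0.
  apply/eqP/det0P; exists (\row_j (lambda j)%:~R).
    by apply: contraNneq li0 => /rowP/(_ i0); rewrite !mxE => /eqP; rewrite intr_eq0.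
  apply/rowP => mu; rewrite !mxE; have /negPn/eqP e0 := h0 mu; rewrite -[RHS]e0.
  by apply: eq_bigr => j _; rewrite !mxE.
rewrite det_tr => /eqP/det0P[g g0 /rowP gE].
have {}gE j : \sum_mu g 0 mu * approx mu j = 0.
  have := gE j; rewrite !mxE => e0; rewrite -[RHS]e0.
  by apply: eq_bigr => mu _; rewrite !mxE.
suff : rVpoly g = 0.
  by move=> g00; case/eqP: g0; rewrite -[g]rVpolyK g00 linear0.
have PE : ('X^n * (\prod_(b <- codom alpha) ('X - b%:P) ^+ n * rVpoly g))^`N(n)
    = \sum_mu g 0 mu *: pade n mu roots_seq.
  have {1}-> : rVpoly g = \sum_mu g 0 mu *: 'X^mu.
    rewrite -[LHS]coefK poly_def (big_ord_widen _ (fun i => (rVpoly g)`_i *: 'X^i) (size_poly _ _)).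
    rewrite big_mkcond; apply: eq_bigr => mu _; rewrite coef_rVpoly_ord; case: ltnP => // h.
    by rewrite -coef_rVpoly_ord nth_default// scale0r.
  rewrite !mulr_sumr linear_sum; apply: eq_bigr => mu _.
  by rewrite -!scalerAr linearZ /= /pade prod_roots_seq.
apply: (@pade_nondegenerate n (codom alpha)).
- by rewrite map_inj_uniq ?enum_uniq.
- by apply/codomP => -[i /esym/eqP]; rewrite (negbTE (a0 i)).
- by rewrite size_codom card_ord size_poly.
- rewrite PE horner_sum -[RHS](gE ord0); apply: eq_bigr => mu _.
  by rewrite hornerZ /approx unlift_none.
- move=> _ /codomP[i ->]; rewrite PE log_form_sum -[RHS](gE (lift ord0 i)).
  by apply: eq_bigr => mu _; rewrite /approx liftK.
Qed.

End Approximants.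

(** * Convergence of the p-adic logarithm *)

Section PadicLog.
Variable p : nat.

Lemma Qp_abs_of_rat x : Qp_abs (Qp_of_rat p x) = padic_abs p x.
Proof. by rewrite -Qp_abs_ratr (fmorph_eq_rat (@Qp_of_rat p)). Qed.

Lemma natr_exp4_le n : n.+1%:R * (1 / 4) ^+ n.+1 <= n.+1%:R^-1 :> rat.
Proof.
have h : (n.+1 * n.+1 <= 4 ^ n.+1)%N.
  by rewrite -[4%N]/(2 * 2)%N expnMn leq_mul// ltnW// ltn_expl.
rewrite div1r exprVn ler_pdivrMr ?exprn_gt0// ler_pdivlMl ?ltr0n//.
by rewrite -natrM -natrX ler_nat.
Qed.

(** Controls the terms a^(k+1)/(k+1) for |a|_p <= 1/4. This range suffices because the hypotheses of
    the theorem force |alpha_i|_p <= 1/42, see [a_le]. *)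
Lemma log_term_small (e : rat) : 0 < e -> exists N, forall k, (N <= k)%N ->
  k.+1%:R * (1 / 4) ^+ k.+1 < e.
Proof.
move=> e0; exists (Num.bound e^-1) => k Nk; apply: le_lt_trans (natr_exp4_le k) _.
rewrite invf_plt ?posrE//; apply: (@lt_le_trans _ _ (Num.bound e^-1)%:R).
  by rewrite archi_boundP// invr_ge0 ltW.
by rewrite ler_nat leqW.
Qed.

Lemma log_sum_cauchy a : padic_abs p a <= 1 / 4 ->
  forall e : rat, 0 < e -> exists N, forall k l, (N <= k)%N -> (N <= l)%N ->
    padic_abs p (log_sum a k - log_sum a l) < e.
Proof.
move=> a4 e e0; have [N hN] := log_term_small e0; exists N.
have h k l : (N <= k <= l)%N -> padic_abs p (log_sum a l - log_sum a k) < e.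
  move=> /andP[Nk kl].
  have -> : log_sum a l - log_sum a k = \sum_(k <= i < l) (-1) ^+ i * a ^+ i.+1 / i.+1%:R.
    rewrite /log_sum -!(big_mkord xpredT (fun i => (-1) ^+ i * a ^+ i.+1 / i.+1%:R)).
    rewrite (@big_cat_nat _ _ _ k 0 l)//=. by rewrite addrAC subrr add0r.
  apply: (@le_lt_trans _ _ (N.+1%:R * (1 / 4) ^+ N.+1)); last exact: hN.
  rewrite big_seq_cond; apply: padic_abs_sum => [|i]; first by rewrite mulr_ge0 ?exprn_ge0.
  rewrite andbT mem_index_iota => /andP[ki _].
  apply: (@le_trans _ _ (i.+1%:R * (1 / 4) ^+ i.+1)); last first.
    by apply: mulr_exp_antitone => //; apply: leq_trans Nk ki.
  rewrite !padic_absM padic_abs_sign mul1r padic_absV padic_absX mulrC.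
  rewrite ler_pM ?invr_ge0 ?exprn_ge0 ?padic_abs_ge0//.
    by rewrite -[leRHS]invrK lef_pV2 ?posrE ?invr_gt0 ?padic_abs_gt0 ?padic_abs_natr_ge ?pnatr_eq0.
  by rewrite lerXn2r ?nnegrE ?padic_abs_ge0.
move=> k l Nk Nl; have [kl|lk] := leqP k l; last by apply: h; rewrite Nl ltnW.
by rewrite -opprB padic_absN h// Nk.
Qed.

Lemma Qp_log_approx a : padic_abs p a <= 1 / 4 ->
  forall e : rat, 0 < e -> exists N, forall k, (N <= k)%N ->
    Qp_abs (Qp_log (1 + ratr a) - Qp_of_rat p (log_sum a k)) < e.
Proof.
move=> a4 e e0.
have E : series (fun n => (-1) ^+ n / n.+1%:R * (1 + ratr a - 1) ^+ n.+1 : Qp p)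
    = (fun k => Qp_of_rat p (log_sum a k)).
  apply/funext => k; rewrite /series /= big_mkord rmorph_sum; apply: eq_bigr => i _.
  rewrite addrC addKr -(fmorph_eq_rat (@Qp_of_rat p)).
  by rewrite !rmorphM /= fmorphV rmorph_nat !rmorphXn rmorphN1 mulrAC.
have cv : cvgn (fun k => Qp_of_rat p (log_sum a k)).
  apply: Qp_complete => e' e'0; have [N hN] := log_sum_cauchy a4 e'0.
  exists N => k l Nk Nl; rewrite -rmorphB Qp_abs_of_rat; exact: hN.
have [N hN] := (Qp_cvgP _ _).1 cv e e0.
exists N => k Nk; rewrite /Qp_log E -opprB Qp_absN; exact: hN.
Qed.

End PadicLog.

(** * The arithmetic lower bound for a given n *)

Section LowerBound.
Variables (p m n : nat) (lambda : 'I_m.+1 -> int) (alpha : 'I_m -> rat) (Q : nat).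
Let M := max_abs alpha.
Let A := max_padic_abs p alpha.
Let q : rat := Q%:R.
Let H : rat := (height lambda)%:R.
Let K := (m * n + m)%N.

Local Notation c := (Qp_of_rat p).

(** A bound for |N| that is uniform in mu, obtained by raising mu to m: there are m+1 summands, each
    at most H times the scaled approximant. *)
Definition pade_bound : rat :=
  m.+1%:R * H * ((lcm_upto K)%:R * q ^+ K *
    (M ^+ K * (M / (M - 1)) * (3 ^+ n * (3 / 2) ^+ m * (5 / 2) ^+ (m * n)))).

Lemma max_abs_ge i : `|alpha i| <= M.
Proof. exact: le_bigmax. Qed.

Lemma max_padic_abs_ge i : padic_abs p (alpha i) <= A.
Proof. exact: le_bigmax. Qed.

Lemma height_ge i : `|(lambda i)%:~R| <= H.
Proof.
rewrite -intr_norm -[H]/((Posz _)%:~R) ler_int.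
by rewrite -abszE lez_nat; apply: (@leq_bigmax _ (fun i => `|lambda i|%N)).
Qed.

Lemma linear_form_lower_bound : (0 < Q)%N ->
  injective alpha -> (forall i, alpha i != 0) -> (exists i, lambda i != 0) ->
  (forall i, q * alpha i \is a Num.int) -> 1 < M -> 0 < A -> A <= 1 / 4 ->
  pade_bound * ((m * n + n).+1%:R * A ^+ (m * n + n).+1) < 1 ->
  pade_bound^-1 <= Qp_abs (linear_form p lambda alpha).
Proof.
move=> Q0 ainj a0 l0 qa M1 A0 A4; set rho := (_ * A ^+ _) => Xrho.
have rho0 : 0 < rho by rewrite mulr_gt0 ?exprn_gt0 ?ltr0n.
have [mu nz] := @approx_nondegenerate m n alpha lambda ainj a0 l0.
have mum : (mu <= m)%N by rewrite -ltnS.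
set r := roots_seq n alpha; have sr : size r = (m * n)%N by exact: size_roots_seq.
pose D : rat := (lcm_upto K)%:R * q ^+ K.
have qZ : q \is a Num.int by rewrite rpred_nat.
have rZ : {in r, forall b, q * b \is a Num.int} by apply: mem_roots_seq.
have rM : {in r, forall b, `|b| <= M} by apply: mem_roots_seq => i; apply: max_abs_ge.
have rA : {in r, forall b, padic_abs p b <= A}.
  by apply: mem_roots_seq => i; apply: max_padic_abs_ge.
have LK : (size r + mu <= K)%N by rewrite sr leq_add2l.
have DE j : D * approx n alpha mu j \is a Num.int.
  rewrite /approx; case: unliftP => [i|] _; first exact: log_form_pade_int.
  exact: horner_pade_int.
have ME j : `|approx n alpha mu j| <=
    M ^+ K * (M / (M - 1)) * (3 ^+ n * (3 / 2) ^+ m * (5 / 2) ^+ (m * n)).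
  apply: (@le_trans _ _ (M ^+ (size r + mu) * (M / (M - 1)) *
      (3 ^+ n * (3 / 2) ^+ mu * (5 / 2) ^+ size r))).
    rewrite /approx; case: unliftP => [i|] _; last exact: pade_norm.
    by apply: log_form_pade_norm => //; exact: max_abs_ge.
  have M0 : 0 <= M by lra.
  have M10 : 0 <= M - 1 by lra.
  rewrite sr; apply: ler_pM.
  - by rewrite mulr_ge0 ?divr_ge0 ?exprn_ge0.
  - by rewrite !mulr_ge0 ?exprn_ge0.
  - by rewrite ler_wpM2r ?divr_ge0// ler_eXn2l// leq_add2l.
  - by rewrite ler_wpM2r ?exprn_ge0// ler_wpM2l ?exprn_ge0// ler_eXn2l.
set B := M ^+ K * _ * _ in ME *.
have D0 : 0 < D by rewrite mulr_gt0 ?exprn_gt0 ?ltr0n ?lcm_upto_gt0.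
pose N := D * \sum_j (lambda j)%:~R * approx n alpha mu j.
have NZ : N \is a Num.int.
  rewrite /N mulr_sumr; apply: rpred_sum => j _.
  by rewrite mulrCA rpredM ?rpred_int.
have N0 : N != 0 by rewrite mulf_neq0// gt_eqF.
have NX : `|N| <= pade_bound.
  rewrite /N normrM (gtr0_norm D0) /pade_bound -/D -/B mulrCA ler_wpM2l ?(ltW D0)//.
  rewrite (le_trans (ler_norm_sum _ _ _))//.
  rewrite -mulrA mulr_natl -[X in _ *+ X]card_ord -sumr_const; apply: ler_sum => j _.
  by rewrite normrM ler_pM// height_ge.
have X0 : 0 < pade_bound by apply: lt_le_trans NX; rewrite normr_gt0.
have NP : pade_bound^-1 <= padic_abs p N.
  by apply: le_trans (padic_abs_int_ge p NZ N0); rewrite lef_pV2 ?posrE ?normr_gt0.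
have rhoX : rho < pade_bound^-1 by rewrite -[_^-1]mul1r ltr_pdivlMr// mulrC.
pose u := D * approx n alpha mu ord0.
have uZ : u \is a Num.int by exact: DE.
pose ell i := Qp_log (1 + ratr (alpha i)) : Qp p.
(* The truncation k is chosen large enough both for the partial sum to be within [rho] of the
   logarithm and for the remainder formula to apply. The integers u and D do not increase p-adic
   absolute values. *)
have rem i : Qp_abs (c u * ell i - c (D * approx n alpha mu (lift ord0 i))) <= rho.
  have ai4 : padic_abs p (alpha i) <= 1 / 4 by rewrite (le_trans (max_padic_abs_ge i)).
  have [k0 hk] := Qp_log_approx ai4 rho0.
  pose k := maxn k0 (size r + mu + n).
  have -> : c u * ell i - c (D * approx n alpha mu (lift ord0 i)) =
     c u * (ell i - c (log_sum (alpha i) k)) +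
     c (D * (approx n alpha mu ord0 * log_sum (alpha i) k - approx n alpha mu (lift ord0 i))).
    by rewrite /u !mulrBr mulrA rmorphB !rmorphM /=; ring.
  rewrite (le_trans (Qp_absD _ _))// ge_max; apply/andP; split.
    rewrite Qp_absM Qp_abs_of_rat -[leRHS]mul1r ler_pM ?padic_abs_ge0 ?Qp_abs_ge0//.
      by rewrite padic_abs_int_le1.
    by rewrite ltW// hk// leq_maxl.
  rewrite Qp_abs_of_rat padic_absM -[leRHS]mul1r ler_pM ?padic_abs_ge0//.
    by rewrite padic_abs_int_le1// rpredM ?rpredX ?rpred_nat.
  rewrite /approx unlift_none liftK.
  apply: (@le_trans _ _ ((size r + mu + n).+1%:R * A ^+ (size r + mu + n).+1)).
    apply: pade_remainder_padic => //; first by rewrite ltW.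
    - by lra.
    - exact: max_padic_abs_ge.
    - rewrite prod_roots_seq (bigD1_seq (alpha i)) /=.
      + exact: dvdp_mulr.
      + exact: codom_f.
      + by rewrite map_inj_uniq ?enum_uniq.
    - exact: leq_maxr.
  by apply: mulr_exp_antitone; rewrite ?sr ?leq_add2r ?leq_addr// ?ltW//; lra.
have key : c N = c u * linear_form p lambda alpha -
    \sum_(i < m) (lambda (lift ord0 i))%:~R * (c u * ell i - c (D * approx n alpha mu (lift ord0 i))).
  rewrite /linear_form mulrDr mulr_sumr -addrA -sumrB /N big_ord_recl mulrDr rmorphD.
  congr (_ + _).
    by rewrite mulrCA rmorphM rmorph_int mulrC.
  rewrite mulr_sumr rmorph_sum; apply: eq_bigr => i _.
  rewrite mulrCA rmorphM /= rmorph_int /ell; ring.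
have cN : Qp_abs (c N) = padic_abs p N by exact: Qp_abs_of_rat.
have lam_le1 (z : int) : Qp_abs (z%:~R : Qp p) <= 1.
  by rewrite -(rmorph_int (Qp_of_rat p)) Qp_abs_of_rat padic_abs_int_le1// rpred_int.
have sum_le : Qp_abs (\sum_(i < m) (lambda (lift ord0 i))%:~R *
    (c u * ell i - c (D * approx n alpha mu (lift ord0 i)))) <= rho.
  apply: (big_ind (fun x => Qp_abs x <= rho)) => [|x y hx hy|i _].
  - by rewrite Qp_abs0 ltW.
  - by rewrite (le_trans (Qp_absD _ _))// ge_max hx.
  - by rewrite Qp_absM -[leRHS]mul1r ler_pM ?Qp_abs_ge0.
have : padic_abs p N <= Num.max (Qp_abs (c u * linear_form p lambda alpha)) rho.
  rewrite -cN key (le_trans (Qp_absD _ _))// Qp_absN ge_max !le_max lexx /=.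
  by rewrite sum_le orbT.
rewrite le_max [X in _ || X]leNgt (lt_le_trans rhoX NP) orbF.
move=> /(le_trans NP)/le_trans; apply.
rewrite Qp_absM -[leRHS]mul1r ler_pM ?Qp_abs_ge0//.
by rewrite Qp_abs_of_rat padic_abs_int_le1.
Qed.
End LowerBound.

(** * Numerical estimates *)

Section ExpBounds.
Variable R : realType.

Lemma expR_ge_partial (x : R) n : 0 <= x ->
  \sum_(i < n) x ^+ i / i`!%:R <= expR x.
Proof.
move=> x0; have cv := @is_cvg_series_exp_coeff R x.
have nd : {homo series (exp_coeff x) : k l / (k <= l)%N >-> k <= l}.
  by apply: nondecreasing_series => k _ _; rewrite /exp_coeff/= divr_ge0 ?exprn_ge0.
by have := nondecreasing_cvgn_le nd cv n; rewrite /series /= big_mkord.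
Qed.

Lemma expR1_gt : 27 / 10 < expR 1 :> R.
Proof.
apply: lt_le_trans (@expR_ge_partial 1 6 ler01).
by rewrite !big_ord_recr big_ord0 /= !expr1n !factS fact0 !natrM; lra.
Qed.

Lemma expR1_lt : expR 1 < 3 :> R.
Proof.
(* This is 1 - x <= e^(-x) at x = 1/8; the eighth power of 8/7 is still below 3. *)
have h : expR (1 / 8) <= 8 / 7 :> R.
  have := expR_ge1Dx (- (1 / 8) : R); rewrite expRN => h.
  rewrite -[leLHS]invrK -[leRHS]invrK lef_pV2 ?posrE ?invr_gt0 ?expR_gt0//; lra.
have -> : 1 = 8%:R * (1 / 8) :> R by lra.
rewrite expRM_natl; apply: (@le_lt_trans _ _ ((8 / 7) ^+ 8)).
  by rewrite lerXn2r ?nnegrE ?expR_ge0//; lra.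
by rewrite !exprS expr0; lra.
Qed.

(** As 3 (45/16) = (5/2)(27/8), this is the comparison that lets 27/8 stand in for e^1.03883. *)
Lemma expR_c103883_gt : 45 / 16 < expR c103883 :> R.
Proof.
apply: lt_le_trans (@expR_ge_partial c103883 6 _); last by rewrite /c103883; lra.
have c1 : (83 / 80 : R) <= c103883 by rewrite /c103883; lra.
have c0 : 0 <= c103883 :> R by lra.
have h i : (83 / 80 : R) ^+ i <= c103883 ^+ i by rewrite lerXn2r ?nnegrE//; lra.
apply: (@lt_le_trans _ _ (\sum_(i < 6) ((83 / 80) ^+ i / i`!%:R))).
  by rewrite !big_ord_recr big_ord0 /= !factS fact0 !natrM !exprS !expr0; lra.
by apply: ler_sum => i _; rewrite ler_wpM2r ?invr_ge0.
Qed.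
End ExpBounds.

Lemma cube_lt_exp2 n : (12 <= n)%N -> ((n.+1) ^ 3 < 2 ^ n)%N.
Proof.
elim: n => // n IH; rewrite leq_eqVlt => /predU1P[<-//|h].
rewrite [(2 ^ _)%N]expnS; apply: (@leq_trans (2 * n.+1 ^ 3).+1); last by rewrite ltn_pmul2l// IH.
rewrite ltnS !expnS expn0 !muln1; nia.
Qed.

(** Together with [a_small] it lets one factor a absorb (m+1)^2 (81/16)^m, because 81/16 =
    (135/16)(3/5). *)
Lemma sqr_exp_le m : (m.+1 ^ 2 * 3 ^ m <= 5 * 5 ^ m)%N.
Proof.
elim: m => // m IH; have [m3|m3] := leqP m 2; first by case: m m3 {IH} => [|[|[]]].
rewrite !(expnS _ m); move: (3 ^ m)%N (5 ^ m)%N IH => t u; nia.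
Qed.

Section Numerics.
Variables (R : realType) (m : nat) (M a H q : R).
Hypotheses (m1 : (1 <= m)%N) (M1 : 1 < M) (q1 : 1 <= q) (a0 : 0 < a).
Hypothesis aqM : 1 <= a * (q * M).
Hypothesis MqM : M / (M - 1) <= q * M.
Let c1 : R := expR c103883.
(** Z a^(m+1) is 1/f, so that [Fbig] says log f >= 1. The exponent of H in the theorem is -1 - 14 ln
    Z. *)
Let Z := 2 * (3 * c1 * (q * M)) ^+ m.
Let L := ln H.
Hypothesis Fbig : expR 1 * (Z * a ^+ m.+1) <= 1.
Hypothesis HM : m.+1%:R * ln M <= L.
Hypothesis Hq : m%:R * ln q <= L.
Hypothesis Hm : m.+2%:R <= H.

Let q0 : 0 < q. Proof. exact: lt_le_trans q1. Qed.
Let M0 : 0 < M. Proof. exact: lt_trans M1. Qed.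
Let qM0 : 0 < q * M. Proof. exact: mulr_gt0. Qed.
Let c1_gt : 45 / 16 < c1. Proof. exact: expR_c103883_gt. Qed.
Let e_gt : 27 / 10 < expR 1 :> R. Proof. exact: expR1_gt. Qed.
Let m2R : (3 : R) <= m.+2%:R. Proof. by rewrite ler_nat. Qed.
Let H0 : 0 < H. Proof. by apply: lt_le_trans Hm; rewrite ltr0n. Qed.
Let HE : H = expR L. Proof. by rewrite lnK. Qed.

Let L1 : 1 <= L.
Proof.
rewrite -ler_expR -HE; apply: le_trans Hm; apply: le_trans m2R.
exact/ltW/expR1_lt.
Qed.

Lemma Z_gt0 : 0 < Z.
Proof. by rewrite /Z !(mulr_gt0, exprn_gt0)// expR_gt0. Qed.

(** In [Fbig], m of the m+1 factors a combine with (qM)^m to give (a q M)^m >= 1, and 2e > 5, 3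
    e^1.03883 > 135/16. *)
Lemma a_small : a * (5 * (135 / 16) ^+ m) <= 1.
Proof.
have c1g := c1_gt; have eg := e_gt.
apply: le_trans Fbig.
have h1 : (135 / 16) ^+ m <= (3 * c1) ^+ m by rewrite lerXn2r ?nnegrE//; lra.
have h2 : 1 <= (a * (q * M)) ^+ m by rewrite exprn_ege1.
have -> : expR 1 * (Z * a ^+ m.+1) =
    a * ((2 * expR 1) * ((3 * c1) ^+ m * (a * (q * M)) ^+ m)).
  by rewrite /Z exprS !exprMn; ring.
have t0 : 0 <= (135 / 16) ^+ m :> R by rewrite exprn_ge0//; lra.
have h3 : (135 / 16) ^+ m <= (3 * c1) ^+ m * (a * (q * M)) ^+ m.
  by rewrite -[leLHS]mulr1; apply: ler_pM.
rewrite ler_wpM2l ?(ltW a0)//; apply: ler_pM => //; lra.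
Qed.

Lemma a_le : a <= 1 / 42.
Proof.
have h : 135 / 16 <= (135 / 16) ^+ m :> R.
  by apply: ler_eXnr => //; lra.
have := a_small; move: a0 h; move: (_ ^+ m) => t; nra.
Qed.

(** The value 81 = 3^4 exceeds e^4, whence [lnZ_ge4]. It follows from q M >= 1/a >= 42. *)
Lemma Z_gt81 : 81 <= Z.
Proof.
have c1g := c1_gt; have qM0' := qM0.
have h : 42 <= q * M.
  have := a_le; move: aqM a0; move: (q * M) qM0 => t; nra.
have b : 42 <= 3 * c1 * (q * M) by nra.
have : 42 <= (3 * c1 * (q * M)) ^+ m.
  have y1 : 1 <= 3 * c1 * (q * M) by lra.
  by apply: le_trans b _; apply: ler_eXnr.
rewrite /Z; move: (_ ^+ m) => t; lra.
Qed.

Lemma lnZ_ge4 : 4 <= ln Z.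
Proof.
rewrite -ler_expR lnK ?posrE ?Z_gt0//; apply: le_trans Z_gt81.
rewrite -[4]mulr1 expRM_natl; have := @expR1_lt R; have := expR_ge0 (1 : R).
move: (expR 1) => t t0 t3.
have t2 : t ^+ 2 <= 9 by rewrite expr2; nra.
have := exprn_ge0 2 t0; rewrite -[4%N]/(2 * 2)%N exprM; move: (t ^+ 2) t2 => u *.
by rewrite expr2; nra.
Qed.

(** M^(m+1) <= H, and q^(m+1) <= q^(2m) <= H^2 because m >= 1. *)
Lemma qM_exp : (q * M) ^+ m.+1 <= expR (3 * L).
Proof.
have L1' := L1.
rewrite -[q * M]lnK ?posrE// -expRM_natl ler_expR lnM ?posrE// mulrDr.
have lq : 0 <= ln q by rewrite ln_ge0.
have : m.+1%:R * ln q <= 2 * (m%:R * ln q).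
  rewrite -natr1 mulrDl mul1r.
  have : 1 <= (m%:R : R) by rewrite ler1n.
  nra.
have := Hq; have := HM; lra.
Qed.

(* With n > 12 log H the factor H^4 is at most e^(n/3). *)
Let n := (Num.truncn (12 * L)).+1.
Let nR : R := n%:R.

Lemma n_gt : 12 * L < nR. Proof. exact: truncnS_gt. Qed.

Lemma n_le : nR <= 12 * L + 1.
Proof.
have L1' := L1.
rewrite /nR /n -natr1 lerD2r; have h : 0 <= 12 * L by have := L1; lra.
by have /andP[] := truncn_itv h.
Qed.

Lemma n_ge12 : (12 <= n)%N.
Proof. by have := n_gt; have := L1; rewrite /nR => ? ?; rewrite -(ler_nat R); lra. Qed.

(* 81/16 = (3/2)(27/8) and 135/16 = (5/2)(27/8), where 27/8 bounds the lcm. *)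
Let X := m.+1%:R * H * (M / (M - 1)) * (81 / 16 * (q * M)) ^+ m *
         (3 * (135 / 16 * (q * M)) ^+ m) ^+ n.

Lemma height_factor_le : H * (M / (M - 1) * (q * M) ^+ m) <= expR (4 * L).
Proof.
have -> : 4 * L = L + 3 * L by lra.
rewrite expRD -HE ler_wpM2l ?(ltW H0)//; apply: le_trans qM_exp.
by rewrite exprS ler_wpM2r ?exprn_ge0 ?(ltW qM0).
Qed.

(** The n-th power of 3 (135/16 q M)^m a^(m+1) is at most w^n with w = 3/(2e). One factor a is left
    over and absorbs everything that grows with m alone, which reduces the claim to H^4 (n+1) w^n <
    1. *)
Lemma numeric_remainder : X * ((m * n + n).+1%:R * a ^+ (m * n + n).+1) < 1.
Proof.
have c1g := c1_gt; have eg := e_gt; have qM0' := qM0.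
have MM : 0 < M / (M - 1) by rewrite divr_gt0// subr_gt0.
have qM135 : 0 <= 135 / 16 * (q * M) by lra.
have eg0 : 0 < expR 1 :> R by exact: expR_gt0.
pose w : R := 3 / 2 / expR 1.
have w0 : 0 <= w by rewrite divr_ge0 ?expR_ge0.
have step : 3 * (135 / 16 * (q * M)) ^+ m * a ^+ m.+1 <= w.
  rewrite /w ler_pdivlMr//.
  have h1 : (135 / 16 * (q * M)) ^+ m <= (3 * c1 * (q * M)) ^+ m.
    have p0 : 0 <= 135 / 16 * (q * M) by lra.
    have h0 : 135 / 16 * (q * M) <= 3 * c1 * (q * M) by move: (q * M) qM0' => z; nra.
    by rewrite lerXn2r ?nnegrE// (le_trans p0 h0).
  apply: (@le_trans _ _ (3 / 2 * (expR 1 * (Z * a ^+ m.+1)))); last by have := Fbig; lra.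
  rewrite /Z; move: (_ ^+ m) (_ ^+ m) h1 => u v uv.
  have : 0 <= expR 1 * a ^+ m.+1 by rewrite mulr_ge0 ?exprn_ge0 ?ltW.
  move: (expR 1) (a ^+ m.+1) => s t st.
  by have := ler_wpM2l st uv; lra.
have w3 : expR 1 * w ^+ 3 <= 1 / 2.
  rewrite /w expr_div_n mulrA ler_pdivrMr ?exprn_gt0//.
  move: (expR 1) eg => e ge; rewrite !exprS expr0.
  have : 27 / 4 <= e * e by nra.
  by move: (e * e) => u hu; nra.
clearbody w.
have nE : (m * n + n)%N = (m.+1 * n)%N by rewrite mulSn addnC.
have -> : a ^+ (m * n + n).+1 = (a ^+ m.+1) ^+ n * a by rewrite exprSr nE exprM.
have En : (m * n + n).+1%:R <= (m.+1%:R * n.+1%:R : R).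
  by rewrite -natrM ler_nat nE mulnS addSn ltnS leq_addl.
have sq : m.+1%:R * m.+1%:R * (81 / 16) ^+ m * a <= (1 : R).
  apply: le_trans a_small.
  have := sqr_exp_le m; rewrite -(ler_nat R) !natrM !natrX => h.
  have -> : 81 / 16 = (135 / 16) * (3 / 5) :> R by lra.
  rewrite exprMn.
  have : m.+1%:R * m.+1%:R * (3 / 5) ^+ m <= (5 : R).
    by rewrite expr_div_n mulrA ler_pdivrMr ?exprn_gt0// -expr2.
  have t0 : 0 <= (135 / 16) ^+ m :> R by rewrite exprn_ge0//; lra.
  have ta0 := mulr_ge0 t0 (ltW a0); move: ((135 / 16) ^+ m) ta0 => t ta0 h'.
  have -> k : k * (t * (3 / 5) ^+ m) * a = (k * (3 / 5) ^+ m) * (t * a) by ring.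
  by have := ler_wpM2r ta0 h'; move: (_ * (3 / 5) ^+ m) => s; lra.
(* The inequality is cubed: H^12 <= e^n by the choice of n, (n+1)^3 < 2^n by [cube_lt_exp2], and e
   w^3 <= 1/2. *)
have main : expR (4 * L) * (n.+1%:R * w ^+ n) < 1.
  rewrite -(@expr_lt1 _ 3)//; last first.
    by rewrite !mulr_ge0 ?expR_ge0 ?exprn_ge0.
  have e12 : expR (4 * L) ^+ 3 <= expR 1 ^+ n.
    rewrite -!expRM_natl ler_expR mulr1; have := n_gt; rewrite /nR => h; lra.
  have c2 : n.+1%:R ^+ 3 < 2 ^+ n :> R.
    by rewrite -!natrX ltr_nat cube_lt_exp2// n_ge12.
  rewrite !exprMn -[w ^+ n ^+ 3]exprM mulnC exprM.
  apply: (@le_lt_trans _ _ (n.+1%:R ^+ 3 * (expR 1 * w ^+ 3) ^+ n)).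
    rewrite [X in _ <= _ * X]exprMn mulrCA; apply: ler_wpM2l; first by rewrite exprn_ge0.
    by apply: ler_wpM2r => //; rewrite !exprn_ge0.
  apply: (@le_lt_trans _ _ (n.+1%:R ^+ 3 * (1 / 2) ^+ n)).
    rewrite ler_wpM2l ?exprn_ge0// lerXn2r ?nnegrE ?mulr_ge0 ?exprn_ge0 ?expR_ge0//.
  by rewrite div1r exprVn ltr_pdivrMr ?exprn_gt0// mul1r.
have EE : m.+1%:R * (81 / 16) ^+ m * a * (m * n + n).+1%:R <= n.+1%:R.
  apply: (@le_trans _ _ ((m.+1%:R * m.+1%:R * (81 / 16) ^+ m * a) * n.+1%:R)); last first.
    by rewrite -[leRHS]mul1r ler_wpM2r.
  have p0 : 0 <= m.+1%:R * (81 / 16) ^+ m * a by rewrite !mulr_ge0 ?exprn_ge0 ?(ltW a0).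
  have := ler_wpM2l p0 En; move: ((81 / 16) ^+ m) {p0} => t h; apply: le_trans h _.
  by rewrite le_eqVlt; apply/orP; left; apply/eqP; ring.
have p0 : 0 <= 3 * (135 / 16 * (q * M)) ^+ m * a ^+ m.+1.
  by rewrite !mulr_ge0 ?exprn_ge0 ?(ltW a0).
have SS : (3 * (135 / 16 * (q * M)) ^+ m * a ^+ m.+1) ^+ n <= w ^+ n.
  by apply: lerXn2r; rewrite ?nnegrE; [exact: p0|exact: w0|exact: step].
have p1 := exprn_ge0 n p0.
apply: le_lt_trans main; rewrite /X [(81 / 16 * _) ^+ m]exprMn.
have p2 : 0 <= m.+1%:R * (81 / 16) ^+ m * a * (m * n + n).+1%:R.
  by rewrite !mulr_ge0 ?exprn_ge0 ?(ltW a0).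
have p3 : 0 <= H * (M / (M - 1) * (q * M) ^+ m).
  exact: mulr_ge0 (ltW H0) (mulr_ge0 (ltW MM) (exprn_ge0 _ (ltW qM0))).
have := ler_pM p3 (mulr_ge0 p2 p1) height_factor_le (ler_pM p2 p1 EE SS).
rewrite [(3 * _ * a ^+ m.+1) ^+ n]exprMn; apply: le_trans.
move: ((3 * _) ^+ n) (a ^+ _ ^+ n) ((81 / 16) ^+ m) ((q * M) ^+ m) (M / _) => b1 b2 b3 b4 b5.
by rewrite le_eqVlt; apply/orP; left; apply/eqP; ring.
Qed.

Lemma pade_base_le : 3 * (135 / 16 * (q * M)) ^+ m <= 3 / 2 * Z.
Proof.
have c1g := c1_gt; have qM0' := qM0.
have p0 : 0 <= 135 / 16 * (q * M) by lra.
have h0 : 135 / 16 * (q * M) <= 3 * c1 * (q * M) by rewrite ler_pM2r//; lra.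
have h1 : (135 / 16 * (q * M)) ^+ m <= (3 * c1 * (q * M)) ^+ m.
  by rewrite lerXn2r ?nnegrE// (le_trans p0 h0).
by rewrite /Z; move: (_ ^+ m) (_ ^+ m) h1 => u v; lra.
Qed.

(** Here 14 arises: after n ln Z <= 12 L ln Z + ln Z, the remaining 2 L ln Z >= 8 L pays for n
    ln(3/2) <= 6 L + 1/2 and for ln 2. *)
Lemma numeric_power :
  (3 * (135 / 16 * (q * M)) ^+ m) ^+ n <= Z / 2 * expR (14 * L * ln Z).
Proof.
have Z0 := Z_gt0; have lZ := lnZ_ge4.
have W0 : 0 <= 3 * (135 / 16 * (q * M)) ^+ m.
  have p0 : 0 <= 135 / 16 * (q * M) by have := qM0; lra.
  by rewrite mulr_ge0 ?exprn_ge0.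
have Z32 : 0 < 3 / 2 * Z by lra.
apply: (@le_trans _ _ ((3 / 2 * Z) ^+ n)).
  by rewrite lerXn2r ?nnegrE ?(ltW Z32)// pade_base_le.
have -> : Z / 2 = expR (ln Z - ln 2) by rewrite expRB !lnK ?posrE.
rewrite -expRD -[3 / 2 * Z]lnK ?posrE// -expRM_natl ler_expR -/nR.
rewrite lnM ?posrE//.
have l32 : ln (3 / 2) <= (1 / 2 : R).
  by have := @le_ln1Dx R (1 / 2); rewrite (_ : 1 + 1 / 2 = 3 / 2); [apply; lra|lra].
have l2 : ln 2 <= (1 : R).
  by have := @le_ln1Dx R 1; rewrite (_ : 1 + 1 = 2); [apply; lra|lra].
have := n_le; have n0 : 0 <= nR by rewrite /nR.
have := L1; move: nR (ln Z) (ln 2) (ln (3 / 2)) L n0 lZ l2 l32 => x z u v l x0 z4 u1 v1 l1 xl.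
have a1 : x * v <= x * (1 / 2) by rewrite ler_wpM2l.
have a2 : x * z <= (12 * l + 1) * z by rewrite ler_wpM2r//; lra.
have a3 : l * 4 <= l * z by rewrite ler_wpM2l//; lra.
lra.
Qed.

Lemma expR_c2 : expR (c207766 * m%:R) = (c1 * c1) ^+ m.
Proof.
rewrite -expRD -expRM_natr; congr expR; congr (_ * _).
by rewrite /c207766 /c103883; field.
Qed.

Lemma numeric_target :
  (M - 1) / (6 ^+ m * m.+1%:R * expR (c207766 * m%:R) * q ^+ m.*2 * M ^+ m.*2.+1)
    * H `^ (-1 - 14 * ln 2 - 14 * m%:R * ln (3 * expR c103883 * q * M)) < X^-1.
Proof.
have c1g := c1_gt; have qM0' := qM0.
have MM : 0 < M / (M - 1) by rewrite divr_gt0// subr_gt0.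
have Z0 := Z_gt0; have lZ := lnZ_ge4.
have c10 : 0 < c1 by exact: expR_gt0.
have lnZE : ln Z = ln 2 + m%:R * ln (3 * c1 * q * M).
  rewrite /Z lnM ?posrE//; last by rewrite exprn_gt0// !mulr_gt0.
  rewrite lnXn; last by rewrite !mulr_gt0.
  by congr (_ + _); rewrite -[LHS]mulr_natl !mulrA.
have -> : H `^ (-1 - 14 * ln 2 - 14 * m%:R * ln (3 * expR c103883 * q * M)) =
    (H * expR (14 * L * ln Z))^-1.
  have -> : (H * expR (14 * L * ln Z))^-1 = expR (- (L + 14 * L * ln Z)).
    by rewrite expRN expRD -HE.
  by rewrite [X in X `^ _]HE -expRM lnZE; congr expR; rewrite -/c1; ring.
rewrite expR_c2.
(* T is the reciprocal of the target in the shape of X: the m-th powers in the denominator split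
   into (3 c1 q M)^m = Z/2 and (2 c1 q M)^m. The strict inequality comes from 81/16 < 2 c1. *)
pose T := m.+1%:R * H * (M / (M - 1)) * (Z / 2 * (2 * c1 * (q * M)) ^+ m) * expR (14 * L * ln Z).
have T0 : 0 < T.
  have cqM : 0 < (2 * c1 * (q * M)) ^+ m by rewrite exprn_gt0// mulr_gt0// mulr_gt0.
  have Z2 : 0 < Z / 2 by rewrite divr_gt0.
  by rewrite /T (mulr_gt0 _ (expR_gt0 _))// (mulr_gt0 _ (mulr_gt0 Z2 cqM))// (mulr_gt0 _ MM)// mulr_gt0.
set D := 6 ^+ m * _ * _ * _ * _.
have TE : T = D / (M - 1) * (H * expR (14 * L * ln Z)).
  have Mn1 : M - 1 != 0 by rewrite subr_eq0 gt_eqF.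
  have e6 : (6 : R) ^+ m = 2 ^+ m * 3 ^+ m by rewrite -exprMn; congr (_ ^+ _); lra.
  rewrite /T /D /Z e6 exprS -addnn !exprD !exprMn.
  move: (2 ^+ m) (3 ^+ m) (c1 ^+ m) (q ^+ m) (M ^+ m) (expR _) => b1 b2 b3 b4 b5 b6.
  by field.
have -> : (M - 1) / D * (H * expR (14 * L * ln Z))^-1 = T^-1.
  by rewrite TE [in RHS]invfM invf_div.
have p135 : 0 < 135 / 16 * (q * M) by lra.
have p81 : 0 < 81 / 16 * (q * M) by lra.
set W := (3 * (135 / 16 * (q * M)) ^+ m) ^+ n.
have W0 : 0 < W by apply: exprn_gt0; apply: mulr_gt0 => //; exact: exprn_gt0.
set cst := m.+1%:R * H * (M / (M - 1)).
have cst0 : 0 < cst by apply: mulr_gt0 MM; apply: mulr_gt0 H0; rewrite ltr0n.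
have h1 : (81 / 16 * (q * M)) ^+ m < (2 * c1 * (q * M)) ^+ m.
  have lt1 : 81 / 16 * (q * M) < 2 * c1 * (q * M) by rewrite ltr_pM2r//; lra.
  by rewrite ltrXn2r ?nnegrE -?lt0n ?(ltW p81) ?(ltW (lt_trans p81 lt1)).
have h2 : W <= Z / 2 * expR (14 * L * ln Z).
  exact: numeric_power.
have XE : X = cst * ((81 / 16 * (q * M)) ^+ m * W) by rewrite /X -mulrA.
have TE' : T = cst * ((2 * c1 * (q * M)) ^+ m * (Z / 2 * expR (14 * L * ln Z))).
  by rewrite /T -/cst -mulrA; congr (_ * _); rewrite mulrAC mulrC.
have X0 : 0 < X by rewrite XE mulr_gt0// mulr_gt0// exprn_gt0.
rewrite ltf_pV2 ?posrE// XE TE' ltr_pM2l//.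
apply: (@lt_le_trans _ _ ((2 * c1 * (q * M)) ^+ m * W)); first by rewrite ltr_pM2r.
by rewrite ler_wpM2l// ltW// (lt_trans _ h1)// exprn_gt0.
Qed.

End Numerics.

(** * The lower bound *)

Section Heights.
Variables (p m : nat) (alpha : 'I_m -> rat) (Q : nat).
Hypotheses (Q0 : (0 < Q)%N) (alpha0 : forall i, alpha i != 0).
Hypothesis Qalpha : forall i, Q%:R * alpha i \is a Num.int.

Lemma max_abs_int : Q%:R * max_abs alpha \is a Num.int.
Proof.
apply: (big_ind (fun x : rat => Q%:R * x \is a Num.int)).
- by rewrite mulr0 rpred0.
- by move=> x y hx hy; rewrite /Num.max; case: ifP.
- move=> i _; have := Qalpha i => /intrP[k ke].
  by rewrite -[Q%:R]ger0_norm// -normrM ke -intr_norm rpred_int.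
Qed.

(** The integer Q M exceeds Q, hence is at least Q + 1, so that M - 1 >= 1/Q. *)
Lemma max_abs_ratio_le : 1 < max_abs alpha ->
  max_abs alpha / (max_abs alpha - 1) <= Q%:R * max_abs alpha.
Proof.
have /intrP[k kE] := max_abs_int; move: (max_abs alpha) kE => M kE M1.
have q0 : 0 < (Q%:R : rat) by rewrite ltr0n.
have : Q%:R + 1 <= Q%:R * M.
  have : (Q%:R : rat) < Q%:R * M by rewrite -[ltLHS]mulr1 ltr_pM2l.
  by rewrite kE -[Q%:R]/((Posz Q)%:~R) ltr_int => h; rewrite -[1]/(1%:~R) -intrD ler_int; lia.
move=> h; rewrite ler_pdivrMr; last by rewrite subr_gt0.
nra.
Qed.

(** The Liouville inequality for the nonzero integer Q alpha_i, whose absolute value is at most Q M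
    and whose p-adic one is at most that of alpha_i. *)
Lemma max_padic_abs_mul_ge (i : 'I_m) : 1 <= max_padic_abs p alpha * (Q%:R * max_abs alpha).
Proof.
have q0 : 0 < (Q%:R : rat) by rewrite ltr0n.
have nz : Q%:R * alpha i != 0 by rewrite mulf_neq0// gt_eqF.
have := padic_abs_int_ge p (Qalpha i) nz.
rewrite padic_absM => h.
have h1 : `|Q%:R * alpha i| <= Q%:R * max_abs alpha.
  by rewrite normrM ger0_norm// ler_wpM2l// max_abs_ge.
have h0 : 0 < `|Q%:R * alpha i| by rewrite normr_gt0.
have h2 : padic_abs p Q%:R * padic_abs p (alpha i) <= max_padic_abs p alpha.
  by rewrite -[leRHS]mul1r ler_pM ?padic_abs_ge0 ?padic_abs_natr_le1// max_padic_abs_ge.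
rewrite -ler_pdivrMr ?(lt_le_trans h0)// mul1r.
apply: le_trans (le_trans h h2).
by rewrite lef_pV2 ?posrE// (lt_le_trans h0).
Qed.

End Heights.

Lemma pade_bound_le (R : realType) (m n : nat) (lambda : 'I_m.+1 -> int)
    (alpha : 'I_m -> rat) (Q : nat) (M : R) : 1 < M ->
  M = ratr (max_abs alpha) ->
  ratr (pade_bound n lambda alpha Q) <=
    m.+1%:R * (height lambda)%:R * (M / (M - 1)) * (81 / 16 * (Q%:R * M)) ^+ m *
         (3 * (135 / 16 * (Q%:R * M)) ^+ m) ^+ n.
Proof.
move=> M1 ME.
have -> : ratr (pade_bound n lambda alpha Q) =
   m.+1%:R * (height lambda)%:R * ((lcm_upto (m * n + m))%:R * Q%:R ^+ (m * n + m) *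
    (M ^+ (m * n + m) * (M / (M - 1)) * (3 ^+ n * (3 / 2) ^+ m * (5 / 2) ^+ (m * n)))) :> R.
  by rewrite ME /pade_bound !(rmorphM, rmorphXn, fmorphV, rmorphB, rmorph1, rmorph_nat).
have d : (lcm_upto (m * n + m))%:R <= (27 / 8) ^+ (m * n + m) :> R.
  by rewrite expr_div_n ler_pdivlMr ?exprn_gt0// -!natrX -natrM ler_nat lcm_upto_leq.
set X := (X in _ <= X).
have -> : X = m.+1%:R * (height lambda)%:R * ((27 / 8) ^+ (m * n + m) * Q%:R ^+ (m * n + m) *
    (M ^+ (m * n + m) * (M / (M - 1)) * (3 ^+ n * (3 / 2) ^+ m * (5 / 2) ^+ (m * n)))).
  rewrite /X (_ : 81 / 16 = 3 / 2 * (27 / 8)); last lra.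
  rewrite (_ : 135 / 16 = 5 / 2 * (27 / 8)); last lra.
  move: (3 / 2 : R) (5 / 2 : R) (27 / 8 : R) (M / _) (Q%:R : R) => x y z Y t.
  rewrite !exprD !exprM !exprMn.
  move: (3 ^+ n) (x ^+ m) (y ^+ m ^+ n) (z ^+ m) (z ^+ m ^+ n) => b1 b2 b3 b4 b5.
  move: (t ^+ m) (t ^+ m ^+ n) (M ^+ m) (M ^+ m ^+ n) => c1 c2 c3 c4; ring.
have M0 : 0 <= M by lra.
have MM : 0 <= M / (M - 1) by rewrite divr_ge0// subr_ge0 ltW.
apply: ler_wpM2l; first by rewrite mulr_ge0.
apply: ler_wpM2r; last by rewrite ler_wpM2r// exprn_ge0.
by rewrite (mulr_ge0 (mulr_ge0 (exprn_ge0 _ M0) MM))// !mulr_ge0 ?exprn_ge0.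
Qed.

Lemma f_bound_ln_ge1 (R : realType) m (M a : R) (Q : nat) :
  0 < M -> 0 < a -> (0 < Q)%N -> 1 <= ln (f_bound m M Q a) ->
  expR 1 * (2 * (3 * expR c103883 * (Q%:R * M)) ^+ m * a ^+ m.+1) <= 1.
Proof.
move=> M0 a0 Q0 h; have q0 : 0 < (Q%:R : R) by rewrite ltr0n.
set Y := 2 * _ * _.
have Y0 : 0 < Y by rewrite /Y !(mulr_gt0, exprn_gt0)// expR_gt0.
have FE : f_bound m M Q a = Y^-1.
  by rewrite /f_bound expRN expRM_natr /Y !exprMn !invfM; ring.
rewrite FE in h.
have : expR 1 <= Y^-1 by rewrite -[leRHS]lnK ?posrE ?invr_gt0// ler_expR.
by move=> hY; rewrite -ler_pdivlMr// mul1r.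
Qed.

Theorem corollary2p6 (R : realType) (p m : nat)
    (lambda : 'I_m.+1 -> int) (alpha : 'I_m -> rat) (Q : nat) :
  prime p -> (1 <= m)%N ->
  (exists i, lambda i != 0) ->
  injective alpha -> (forall i, alpha i != 0) ->
  (0 < Q)%N -> (forall i, Q%:R * alpha i \is a Num.int) ->
  let M : R := ratr (max_abs alpha) in
  let a : R := ratr (max_padic_abs p alpha) in
  let H : R := (height lambda)%:R in
  let F : R := f_bound m M Q a in
  1 < M -> a < 1 -> 1 < H ->
  - (expR 1)^-1 <=
    - ln F / (2 ^+ m.-1 * expR (c103883 * m%:R) * Q%:R ^+ m * H
              * (M ^+ m.+1 / (M - 1)) * (m.+1%:R * m.+2%:R) * a) ->
  1 <= ln F ->
  Num.max (Num.max (c103883 * m%:R) (m.+1%:R * ln M))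
          (Num.max (ln m.+2%:R) (m%:R * ln Q%:R)) <= ln H ->
  (M - 1) / (6 ^+ m * m.+1%:R * expR (c207766 * m%:R)
             * Q%:R ^+ m.*2 * M ^+ m.*2.+1)
    * H `^ (-1 - 14 * ln 2 - 14 * m%:R * ln (3 * expR c103883 * Q%:R * M))
  < ratr (Qp_abs (linear_form p lambda alpha)).
Proof.
move=> _ m1 l0 ainj a0 Q0 Qa M a H F M1 _ H1 _ F1.
rewrite !ge_max => /andP[/andP[_ HM] /andP[Hm Hq]].
have Mq1 : 1 < max_abs alpha by rewrite -(@ltr_rat R) rmorph1.
pose i0 : 'I_m := Ordinal m1.
have Aq0 : 0 < max_padic_abs p alpha.
  by apply: lt_le_trans (max_padic_abs_ge p alpha i0); rewrite padic_abs_gt0.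
have A0 : 0 < a by rewrite -(rmorph0 (@ratr R)) ltr_rat.
have q1 : 1 <= (Q%:R : R) by rewrite ler1n.
have aqM : 1 <= a * (Q%:R * M).
  have := max_padic_abs_mul_ge p Q0 a0 Qa i0.
  by rewrite -(@ler_rat R) rmorph1 !rmorphM rmorph_nat.
have MqM : M / (M - 1) <= Q%:R * M.
  have := max_abs_ratio_le Q0 Qa Mq1.
  by rewrite -(@ler_rat R) rmorphM fmorphV rmorphB rmorph1 rmorphM rmorph_nat.
have Hm' : m.+2%:R <= H.
  by rewrite -ler_ln ?posrE// (lt_trans ltr01 H1).
have Fb := f_bound_ln_ge1 (lt_trans ltr01 M1) A0 Q0 F1.
have main := numeric_remainder m1 M1 q1 A0 aqM MqM Fb HM Hq Hm'.
(* The chain is: target < 1/X <= 1/[pade_bound] <= |Lambda|_p, where X is the real majorant of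
   [pade_bound] supplied by [pade_bound_le]. *)
apply: lt_le_trans (numeric_target m1 M1 q1 A0 aqM Fb Hm') _.
set n := (Num.truncn (12 * ln H)).+1 in main *.
have Xle := @pade_bound_le R m n lambda alpha Q M M1 erefl.
have M0 : 0 < M by rewrite (lt_trans ltr01).
have X0 : 0 < ratr (pade_bound n lambda alpha Q) :> R.
  rewrite -(rmorph0 (@ratr R)) ltr_rat /pade_bound.
  have ltM : 0 < max_abs alpha / (max_abs alpha - 1).
    by rewrite divr_gt0 ?subr_gt0// (lt_trans ltr01).
  have ltH : 0 < ((height lambda)%:R : rat) by rewrite ltr0n -(ltr0n R) (lt_trans ltr01).
  have q0 : 0 < (Q%:R : rat) by rewrite ltr0n.
  have Mq0 : 0 < max_abs alpha by rewrite (lt_trans ltr01).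
  apply: mulr_gt0; first by rewrite mulr_gt0.
  apply: mulr_gt0; first by rewrite mulr_gt0 ?exprn_gt0 ?ltr0n ?lcm_upto_gt0.
  apply: mulr_gt0; first by rewrite mulr_gt0 ?exprn_gt0.
  by rewrite !mulr_gt0 ?exprn_gt0.
have rho0 : 0 <= (m * n + n).+1%:R * a ^+ (m * n + n).+1 by rewrite mulr_ge0// exprn_ge0// ltW.
have Ale : max_padic_abs p alpha <= 1 / 4.
  rewrite -(@ler_rat R) rmorphM fmorphV rmorph1 rmorph_nat.
  by apply: le_trans (a_le m1 A0 aqM Fb) _; rewrite !div1r lef_pV2 ?posrE// ler_nat.
have key := @linear_form_lower_bound p m n lambda alpha Q Q0 ainj a0 l0 Qa Mq1 Aq0 Ale.
have {}key : (pade_bound n lambda alpha Q)^-1 <= Qp_abs (linear_form p lambda alpha).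
  have rhoE x : ratr (x * ((m * n + n).+1%:R * max_padic_abs p alpha ^+ (m * n + n).+1)) =
      ratr x * ((m * n + n).+1%:R * a ^+ (m * n + n).+1) by rewrite !rmorphM rmorph_nat rmorphXn.
  by apply: key; rewrite -(@ltr_rat R) rmorph1 rhoE (le_lt_trans _ main)// ler_wpM2r.
apply: (@le_trans _ _ (ratr (pade_bound n lambda alpha Q)^-1)); last by rewrite ler_rat.
by rewrite fmorphV lef_pV2 ?posrE// (lt_le_trans X0 Xle).
Qed.
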